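(* Let $N\ge 1$ be an integer, $0<\theta\le 2$, $p>1$, $0<\gamma<\min\{\theta,N\}$, and, if $0<\theta<2$, assume in addition $\gamma<\theta(p-1)$. Put $p_\gamma:=1+\frac{\theta-\gamma}{N}$ and $p_0:=1+\frac{\theta}{N}$. Let $z\in\mathbb{R}^N$ and let $\mu=\delta_z$ be the Dirac measure concentrated at $z$. Consider the Cauchy problem $$\partial_t u+(-\Delta)^{\theta/2}u=|x|^{-\gamma}u^p,\quad x\in\mathbb{R}^N,\ t>0,\qquad u(0)=\mu\ \text{ in }\mathbb{R}^N. \qquad (\ast)$$ Then the following hold. (1) If $p\ge p_\gamma$ and $z=0$, problem $(\ast)$ possesses no local-in-time solution (in the sense defined in the context). (2) If $p\ge p_0$ and $z\in\mathbb{R}^N$ is arbitrary, problem $(\ast)$ possesses no local-in-time solution.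
   Context: $(-\Delta)^{\theta/2}$ is the fractional power of $-\Delta$ in $\mathbb{R}^N$. $G=G(x,t)$ denotes the fundamental solution (heat kernel) of $\partial_t v+(-\Delta)^{\theta/2}v=0$ in $\mathbb{R}^N\times(0,\infty)$, i.e. $G(x,t)=(2\pi)^{-N}\int_{\mathbb{R}^N}e^{ix\cdot\xi-t|\xi|^\theta}\,d\xi$. Definition of solution: for $0<T\le\infty$, a nonnegative measurable function $u$ on $\mathbb{R}^N\times(0,T)$ is a solution of the Cauchy problem in $\mathbb{R}^N\times[0,T)$ if $$\infty>u(x,t)=\int_{\mathbb{R}^N}G(x-y,t)\,d\mu(y)+\int_0^t\int_{\mathbb{R}^N}G(x-y,t-s)|y|^{-\gamma}u(y,s)^p\,dy\,ds$$ for almost all $x\in\mathbb{R}^N$ and $0<t<T$. A local-in-time solution is a solution in $\mathbb{R}^N\times[0,T)$ for some $T>0$. *)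

(* Defs.v *)
From HB Require Import structures.
From mathcomp Require Import all_boot all_order all_algebra.
From mathcomp Require Import all_classical all_reals all_analysis measurable_realfun.
From mathcomp Require Import complex.

Set Implicit Arguments.
Unset Strict Implicit.
Unset Printing Implicit Defensive.
Import Order.TTheory GRing.Theory Num.Theory.
Import numFieldNormedType.Exports.

Local Open Scope classical_set_scope.
Local Open Scope ring_scope.
Local Open Scope complex_scope.

(* 'rV[R]_n carries the sigma-algebra generated by the coordinates, built as
   the library builds the one of n.-tuple R; this is the Borel sigma-algebra
   of R^n. *)
Section measurable_rV.
Context {R : realType} (n : nat).

Let coor (i : 'I_n) (x : 'rV[R]_n) : R := x 0 i.

Let rV_set0 : g_sigma_preimage coor set0.
Proof. exact: sigma_algebra0. Qed.

Let rV_setC A : g_sigma_preimage coor A -> g_sigma_preimage coor (~` A).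
Proof. exact: sigma_algebraC. Qed.

Let rV_bigcup (F : _^nat) : (forall i, g_sigma_preimage coor (F i)) ->
  g_sigma_preimage coor (\bigcup_i (F i)).
Proof. exact: sigma_algebra_bigcup. Qed.

HB.instance Definition _ := @isMeasurable.Build
  (measure_tuple_display default_measure_display)
  'rV[R]_n (g_sigma_preimage coor) rV_set0 rV_setC rV_bigcup.

End measurable_rV.

Section lebesgue_rV.
Context {R : realType}.

Lemma measurable_coord n (i : 'I_n) :
  measurable_fun [set: 'rV[R]_n] (fun x : 'rV[R]_n => x 0 i).
Proof.
move=> _ Y mY; rewrite setTI; apply: sub_sigma_algebra => /=.
rewrite -bigcup_seq/=; exists i => /=; first by rewrite mem_index_enum.
by exists Y => //; rewrite setTI.
Qed.

Lemma measurable_fun_rV d (T : measurableType d) n (f : T -> 'rV[R]_n) :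
  (forall i, measurable_fun [set: T] (fun t => f t 0 i)) ->
  measurable_fun [set: T] f.
Proof.
move=> mf _ Y mY.
suff H : (@measurable _ 'rV[R]_n) `<=`
    [set A | measurable (setT `&` f @^-1` A)] by exact: H.
apply: smallest_sub => /=.
  split=> /=.
  - by rewrite preimage_set0 setI0.
  - move=> A; rewrite !setTI setTD preimage_setC; exact: measurableC.
  - by move=> F mF; rewrite preimage_bigcup setI_bigcupr; exact: bigcup_measurable.
rewrite -bigcup_seq => A [i _]; rewrite /preimage_set_system => -[B mB <-] /=.
by have := mf i measurableT _ mB; rewrite !setTI.
Qed.

Lemma measurable_box n (A : 'I_n -> set R) : (forall i, measurable (A i)) ->
  measurable [set x : 'rV[R]_n | forall i, A i (x 0 i)].
Proof.
move=> mA; have -> : [set x : 'rV[R]_n | forall i, A i (x 0 i)] =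
    \big[setI/setT]_(i < n) ([set: 'rV[R]_n] `&` (fun x => x 0 i) @^-1` A i).
  rewrite -bigcap_seq; apply/seteqP; split=> x /= Ax i; first by split.
  by have [|_] := Ax i => //; rewrite /= mem_index_enum.
by apply: bigsetI_measurable => i _; exact: measurable_coord.
Qed.

Definition cons_rV n (x : measurableTypeR R * 'rV[R]_n) : 'rV[R]_n.+1 :=
  row_mx (x.1)%:M x.2.

Lemma cons_rV0 n (x : measurableTypeR R * 'rV[R]_n) : cons_rV x 0 ord0 = x.1.
Proof.
have e : ord0 = lshift n ord0 :> 'I_(1 + n) by exact/val_inj.
rewrite [LHS](congr1 (row_mx (x.1%:M : 'M[R]_1) x.2 0) e) row_mxEl mxE.
by rewrite eqxx mulr1n.
Qed.

Lemma cons_rVS n (x : measurableTypeR R * 'rV[R]_n) (i : 'I_n) :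
  cons_rV x 0 (lift ord0 i) = x.2 0 i.
Proof.
have e : lift ord0 i = rshift 1 i :> 'I_(1 + n) by exact/val_inj.
by rewrite [LHS](congr1 (row_mx (x.1%:M : 'M[R]_1) x.2 0) e) row_mxEr.
Qed.

Lemma measurable_cons_rV n :
  measurable_fun [set: measurableTypeR R * 'rV[R]_n] (@cons_rV n).
Proof.
apply: measurable_fun_rV => i; case: (unliftP ord0 i) => [j|] ->.
  under eq_fun do rewrite cons_rVS.
  exact: (measurableT_comp (measurable_coord j) measurable_snd).
under eq_fun do rewrite cons_rV0.
exact: measurable_fst.
Qed.

Let uncons_rV n (x : 'rV[R]_n.+1) : measurableTypeR R * 'rV[R]_n :=
  (x 0 ord0, \row_i x 0 (lift ord0 i)).

Let cons_rVK n : cancel (@cons_rV n) (@uncons_rV n).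
Proof.
move=> [a x]; rewrite /uncons_rV cons_rV0; congr pair.
by apply/rowP => i; rewrite mxE cons_rVS.
Qed.

Let measurable_uncons_rV n : measurable_fun [set: 'rV[R]_n.+1] (@uncons_rV n).
Proof.
apply: measurable_fun_pair; first exact: measurable_coord.
apply: measurable_fun_rV => i; under eq_fun do rewrite mxE.
exact: measurable_coord.
Qed.

Section lebesgue_cons.
Variables (n : nat) (m : {sigma_finite_measure set 'rV[R]_n -> \bar R}).

(* The product of the Lebesgue measure of R with m, seen on R^(n+1). *)
Definition lebesgue_cons : set 'rV[R]_n.+1 -> \bar R :=
  pushforward (lebesgue_measure \x m)%E (@cons_rV n).

Let lebesgue_cons0 : lebesgue_cons set0 = 0%E.
Proof. by rewrite /lebesgue_cons /pushforward preimage_set0 measure0. Qed.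

Let lebesgue_cons_ge0 A : (0 <= lebesgue_cons A)%E.
Proof. by rewrite /lebesgue_cons /pushforward measure_ge0. Qed.

Let lebesgue_cons_sigma_additive : semi_sigma_additive lebesgue_cons.
Proof.
move=> F mF tF mUF; rewrite /lebesgue_cons /pushforward preimage_bigcup.
have mpre A : measurable A -> measurable (@cons_rV n @^-1` A).
  by move=> mA; rewrite -[X in measurable X]setTI; exact: measurable_cons_rV.
apply: measure_semi_sigma_additive.
- by move=> k; exact: mpre.
- apply/trivIsetP => /= i j _ _ ij; rewrite -preimage_setI.
  by move/trivIsetP : tF => /(_ _ _ _ _ ij) ->//; rewrite preimage_set0.
- by rewrite -preimage_bigcup; exact: mpre.
Qed.

HB.instance Definition _ := isMeasure.Build _ _ _ lebesgue_cons
  lebesgue_cons0 lebesgue_cons_ge0 lebesgue_cons_sigma_additive.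

Lemma lebesgue_cons_box (A : 'I_n.+1 -> set R) : (forall i, measurable (A i)) ->
  lebesgue_cons [set x : 'rV[R]_n.+1 | forall i, A i (x 0 i)] =
  (lebesgue_measure (A ord0) *
   m [set x : 'rV[R]_n | forall i : 'I_n, A (lift ord0 i) (x 0%R i)])%E.
Proof.
move=> mA; rewrite -product_measure1E; last 2 first.
- exact: mA.
- exact: (measurable_box (fun i => mA (lift ord0 i))).
rewrite /lebesgue_cons /pushforward; congr (_ _).
apply/seteqP; split=> [[a x] /= Ax|[a x] [/= Aa Ax] i].
  split=> [|i]; first by have := Ax ord0; rewrite cons_rV0.
  by have := Ax (lift ord0 i); rewrite cons_rVS.
by case: (unliftP ord0 i) => [j|] ->; rewrite ?cons_rVS ?cons_rV0.
Qed.

Let lebesgue_cons_sigma_finite : sigma_finite setT lebesgue_cons.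
Proof.
have /sigma_finiteP[F [TF ndF Foo]] := sigma_finiteT (@lebesgue_measure R).
have /sigma_finiteP[G [TG ndG Goo]] := sigma_finiteT m.
have FG : setT = \bigcup_k (F k `*` G k).
  rewrite -setXTT TF TG predeqE => -[x y]; split.
    move=> [/= [n1 _ Fnx] [k _ Gky]]; exists (maxn n1 k) => //; split.
    - by move: x Fnx; exact/subsetPset/ndF/leq_maxl.
    - by move: y Gky; exact/subsetPset/ndG/leq_maxr.
  by move=> [k _ []/= ? ?]; split; exists k.
exists (fun k => (@uncons_rV n) @^-1` (F k `*` G k)).
  by rewrite -preimage_bigcup -FG preimage_setT.
move=> k; have [mF Fkoo] := Foo k; have [mG Gkoo] := Goo k; split.
  rewrite -[X in measurable X]setTI; apply: measurable_uncons_rV => //.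
  exact: measurableX.
rewrite /lebesgue_cons /pushforward -comp_preimage.
rewrite (_ : _ \o _ = id); last by apply/funext => x; exact: cons_rVK.
by rewrite preimage_id product_measure1E// lte_mul_pinfty// ge0_fin_numE.
Qed.

HB.instance Definition _ := Measure_isSigmaFinite.Build _ _ _ lebesgue_cons
  lebesgue_cons_sigma_finite.

End lebesgue_cons.

(* Lebesgue measure on R^n, as an iterated product; see lebesgue_rV_box. *)
Fixpoint lebesgue_rV n : {sigma_finite_measure set 'rV[R]_n -> \bar R} :=
  match n with
  | 0 => \d_(0 : 'rV[R]_0)
  | n'.+1 => lebesgue_cons (lebesgue_rV n')
  end.

Lemma lebesgue_rV_box n (A : 'I_n -> set R) : (forall i, measurable (A i)) ->
  lebesgue_rV n [set x : 'rV[R]_n | forall i, A i (x 0 i)] =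
  (\prod_(i < n) lebesgue_measure (A i))%E.
Proof.
elim: n A => [|n IH] A mA /=.
  by rewrite big_ord0 diracE mem_set// => -[].
rewrite lebesgue_cons_box// big_ord_recl; congr (_ * _)%E.
exact: (IH (fun i => A (lift ord0 i))).
Qed.

End lebesgue_rV.

Section cauchy_problem.
Context {R : realType} (N : nat).
Implicit Types (x y xi : 'rV[R]_N) (t s theta p gamma : R).

Definition dot x y : R := \sum_(i < N) x 0 i * y 0 i.

(* The norm `|x| of the library on 'rV[R]_N is the sup norm. *)
Definition enorm x : R := Num.sqrt (dot x x).

Definition cexp (z : R[i]) : R[i] :=
  (expR (complex.Re z))%:C * (cos (complex.Im z) +i* sin (complex.Im z)).

Definition cintegral (f : 'rV[R]_N -> R[i]) : R[i] :=
  (\int[lebesgue_rV N]_xi complex.Re (f xi)) +i*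
  (\int[lebesgue_rV N]_xi complex.Im (f xi)).

(* The integral defining the kernel is a real number; Re only casts it from
   R[i] to R. *)
Definition heat_kernel theta x t : R :=
  complex.Re (((2 * pi) ^- N)%:C *
    cintegral (fun xi => cexp ('i%C * (dot x xi)%:C - (t * enorm xi `^ theta)%:C))).

Definition spacetime_measure : set ('rV[R]_N * measurableTypeR R) -> \bar R :=
  (lebesgue_rV N \x lebesgue_measure)%E.

(* R^N x R with the Lebesgue measurable sets, i.e. the completion of the product
   sigma-algebra. *)
Definition lebesgue_spacetime :=
  g_sigma_algebraType (completed_algebra_gen spacetime_measure).

(* u takes values in \bar R and only its restriction to R^N x ]0, T[ matters,
   with 0 < T <= +oo.  The real power 0 `^ (- gamma) is 0 in the library
   instead of +oo; this concerns the single point y = 0, which is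
   Lebesgue-negligible when N >= 1. *)
Definition is_solution theta p gamma (mu : {measure set 'rV[R]_N -> \bar R})
    (T : \bar R) (u : 'rV[R]_N * measurableTypeR R -> \bar R) : Prop :=
  let D : set ('rV[R]_N * measurableTypeR R) :=
    [set xt | 0 < (xt.2 : R) /\ (xt.2%:E < T)%E] in
  [/\ measurable_fun (D : set lebesgue_spacetime) u,
      forall xt, D xt -> (0 <= u xt)%E &
      {ae spacetime_measure, forall xt, D xt ->
        (u xt < +oo /\
         u xt =
         \int[mu]_y (heat_kernel theta (xt.1 - y) xt.2)%:E +
         \int[lebesgue_measure]_(s in `]0%R, xt.2[)
           \int[lebesgue_rV N]_y
             ((heat_kernel theta (xt.1 - y) (xt.2 - s) * enorm y `^ (- gamma))%:E
              * u (y, s) `^ p))%E}].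

Definition has_local_solution theta p gamma
    (mu : {measure set 'rV[R]_N -> \bar R}) : Prop :=
  exists T : \bar R, (0 < T)%E /\
  exists u, is_solution theta p gamma mu T u.

End cauchy_problem.

(* Main.v *)
Require Import Defs.
From HB Require Import structures.
From mathcomp Require Import all_boot all_order all_algebra.
From mathcomp Require Import all_classical all_reals all_analysis.
From mathcomp Require Import measurable_realfun ring lra complex.

(* A solution u dominates the kernel G(x - z, t) because G >= 0.  By scaling,
   G(w, t) >= c t^(-N/theta) for |w| <= eps t^(1/theta), so that near z the
   nonlinear term of the integral equation at a fixed point (x, t) is at least
   the integral over small s of a constant times s^((N - kappa - Np)/theta),
   where kappa = gamma if z = 0 and kappa = 0 in general.  This diverges when
   p >= 1 + (theta - kappa)/N.
     The positivity of G for theta <= 2 is obtained from that of the Fourier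
   transform of Gaussians: multiplication by exp(-c(1 - exp(-s|xi|^2))), a
   convergent series of Gaussians with nonnegative coefficients, preserves
   positive definiteness, and |xi|^theta is a limit of nonnegative
   combinations of functions 1 - exp(-s|xi|^2). *)

Set Implicit Arguments.
Unset Strict Implicit.
Unset Printing Implicit Defensive.
Import Order.TTheory GRing.Theory Num.Theory.
Import numFieldNormedType.Exports.
Local Open Scope classical_set_scope.
Local Open Scope ring_scope.

(** The equation holds only off a null set of space-time, and [u] is measurable only for the
    completed sigma-algebra. Lower bounds therefore come from explicit measurable minorants, null
    sets are removed on the side of the minorant, and no measurability is asked of the larger
    integrand. The point [(x, t)] must itself lie off the null set, which is why [x] is merely close
    to [z]; divergence there contradicts the finiteness of [u (x, t)]. Away from the origin the
    kernel enters through its sign alone. Near the origin the quantitative bound comes from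
    [cos v >= 1 - v^2 / 2] together with the mass and second moment of exp(-|xi|^theta). For the
    power l^alpha, a sum over a geometric lattice takes the place of the integral formula: dividing
    by its value at 1 normalizes it, so no constant has to be evaluated, and monotonicity controls
    it between lattice points. *)

Section integral_tools.
Context d (T : measurableType d) (R : realType).
Variable mu : {measure set T -> \bar R}.

(** The integral of a nonnegative function is a supremum over the simple functions below it, and
    those below [f] are also below [g]. *)
Lemma ge0_le_integral_nomeas (D : set T) (f g : T -> \bar R) :
  (forall x, D x -> (0 <= f x)%E) -> (forall x, D x -> (f x <= g x)%E) ->
  (\int[mu]_(x in D) f x <= \int[mu]_(x in D) g x)%E.
Proof.
move=> f0 fg; rewrite !ge0_integralE//; last first.
  by move=> x Dx; exact: le_trans (f0 _ Dx) (fg _ Dx).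
apply: ereal_sup_le => _ [h /= hf <-]; exists h => // x.
apply: le_trans (hf x) _; rewrite /patch; case: ifPn => // xD.
by apply: fg; rewrite inE in xD.
Qed.

(* The null set is removed on the side of f, where measurability is available. *)
Lemma ae_ge0_le_integral_nomeas (D A : set T) (f g : T -> \bar R) :
  measurable D -> measurable A -> mu A = 0%E ->
  measurable_fun D f -> (forall x, D x -> (0 <= f x)%E) ->
  (forall x, D x -> (0 <= g x)%E) ->
  (forall x, D x -> ~ A x -> (f x <= g x)%E) ->
  (\int[mu]_(x in D) f x <= \int[mu]_(x in D) g x)%E.
Proof.
move=> mD mA A0 mf f0 g0 fg.
rewrite (@ge0_negligible_integral _ _ _ mu D A)//.
rewrite setDE integral_mkcondr; apply: ge0_le_integral_nomeas => x Dx.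
  by rewrite /patch; case: ifPn => // _; exact: f0.
by rewrite /patch; case: ifPn => [|_]; [rewrite inE; exact: fg|exact: g0].
Qed.

End integral_tools.

(** The multiple [f a] of the indicator of the point is a measurable minorant, so [f] itself may be
    arbitrary. *)
Lemma ge0_le_dirac_integral d (T : measurableType d) (R : realType) (a : T)
    (f : T -> \bar R) :
  measurable [set a] -> (forall x, (0 <= f x)%E) ->
  (f a <= \int[\d_a]_x f x)%E.
Proof.
move=> ma f0; have mg : measurable_fun setT (fun x => f a * (\1_[set a] x)%:E)%E.
  by apply: emeasurable_funM => //; apply/measurable_EFinP; exact: measurable_indic.
have -> : f a = (\int[\d_a]_x (f a * (\1_[set a] x)%:E))%E.
  by rewrite integral_dirac//= diracT mul1e indicE mem_set// mule1.
apply: ge0_le_integral_nomeas => x _.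
  by rewrite mule_ge0// lee_fin indicE.
rewrite indicE; have [|xa] := boolP (x \in [set a]).
  by rewrite inE => ->; rewrite mule1.
by rewrite mule0.
Qed.

(** * Affine changes of variable on the real line *)

Section lebesgue_affine.
Context {R : realType}.
Notation mu := (@lebesgue_measure R).

Lemma ge0_integral_affine (c b : R) (f : R -> \bar R) : 0 < c ->
  measurable_fun setT f -> (forall x, 0 <= f x)%E ->
  (\int[mu]_x f x = c%:E * \int[mu]_x f (c * x + b)%R)%E.
Proof.
move=> c0 mf f0.
pose phi : measurableTypeR R -> measurableTypeR R := fun x => c * x + b.
have mphi : measurable_fun setT phi.
  by apply: measurable_funD => //; exact: measurable_funM.
pose nu : {measure set (measurableTypeR R) -> \bar R} :=
  ltac:(refine (pushforward mu phi); exact mphi).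
pose k : {nonneg R} := NngNum (ltW c0).
(* By uniqueness of Lebesgue measure it suffices to compare both sides on half-open intervals. *)
have E A : measurable A -> mu A = mscale k nu A.
  apply: (lebesgue_measure_unique (mu := mscale k nu)) => _ [[a e]] _ <- /=.
  rewrite /mscale /= /pushforward.
  rewrite (_ : phi @^-1` _ = `]((a - b) / c), ((e - b) / c)]%classic); last first.
    apply/seteqP; split=> x /=; rewrite !in_itv/= /phi.
      by rewrite ltr_pdivrMr// ler_pdivlMr// ltrBlDr lerBrDr mulrC.
    by rewrite ltr_pdivrMr// ler_pdivlMr// ltrBlDr lerBrDr mulrC.
  rewrite !lebesgue_measure_itv/= !lte_fin ltr_pM2r ?invr_gt0// ltrD2r.
  case: ifPn => _; last by rewrite mule0.
  rewrite -!EFinD -EFinM; congr EFin.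
  by field; rewrite gt_eqF.
transitivity (\int[mscale k nu]_x f x)%E.
  by apply: eq_measure_integral => A mA _; exact: E.
by rewrite ge0_integral_mscale//= ge0_integral_pushforward.
Qed.

Lemma integral_translate (b : R) (f : R -> \bar R) : measurable_fun setT f ->
  (\int[mu]_x f (x + b)%R = \int[mu]_x f x)%E.
Proof.
move=> mf; rewrite [RHS]integralE [LHS]integralE.
rewrite (@ge0_integral_affine 1 b f^\+%E)//; last exact: measurable_funepos.
rewrite (@ge0_integral_affine 1 b f^\-%E)//; last exact: measurable_funeneg.
by rewrite !mul1e; congr (_ - _)%E; apply: eq_integral => x _; rewrite mul1r ?funeposE ?funenegE.
Qed.

Lemma integral_reflect (f : R -> \bar R) : measurable_fun setT f ->
  (\int[mu]_x f (- x)%R = \int[mu]_x f x)%E.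
Proof.
move=> mf.
have H (g : R -> \bar R) : measurable_fun setT g -> (forall x, (0 <= g x)%E) ->
  (\int[mu]_x g x = \int[mu]_x g (- x)%R)%E.
  move=> mg g0.
  pose nu : {measure set (measurableTypeR R) -> \bar R} :=
    ltac:(refine (pushforward mu (-%R : measurableTypeR R -> measurableTypeR R));
          exact: oppr_measurable).
  transitivity (\int[nu]_x g x)%E.
    by apply: eq_measure_integral => A mA _; exact/esym/lebesgue_measureN.
  by rewrite ge0_integral_pushforward.
rewrite [RHS]integralE [LHS]integralE.
rewrite (H f^\+%E)//; last exact: measurable_funepos.
rewrite (H f^\-%E)//; last exact: measurable_funeneg.
by congr (_ - _)%E; apply: eq_integral => x _; rewrite ?funeposE ?funenegE.
Qed.

End lebesgue_affine.

(** * Iterated integrals and dilations in R^n *)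

Section integral_rV.
Context {R : realType}.
Notation mu := (@lebesgue_measure R).

Lemma ge0_integral_rVS n (f : 'rV[R]_n.+1 -> \bar R) :
  measurable_fun setT f -> (forall x, 0 <= f x)%E ->
  (\int[lebesgue_rV n.+1]_x f x =
   \int[mu]_a \int[lebesgue_rV n]_y f (cons_rV (a, y)))%E.
Proof.
move=> mf f0.
transitivity (\int[mu \x lebesgue_rV n]_w f (cons_rV w))%E.
  have := @ge0_integral_pushforward _ _ _ _ R _ (@measurable_cons_rV R n)
     (mu \x lebesgue_rV n)%E setT f measurableT mf.
  by apply => x _.
rewrite (fubini_tonelli1 (f \o @cons_rV R n))//=; last first.
apply: measurableT_comp => //; exact: measurable_cons_rV.
Qed.

Lemma integrable_rVS n (f : 'rV[R]_n.+1 -> \bar R) :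
  (lebesgue_rV n.+1).-integrable setT f ->
  (mu \x lebesgue_rV n)%E.-integrable setT (f \o @cons_rV R n).
Proof.
move=> /integrableP[mf foo]; apply/integrableP; split.
  by apply: measurableT_comp => //; exact: measurable_cons_rV.
apply: le_lt_trans foo; rewrite ge0_integral_rVS//; last first.
  exact: measurableT_comp.
rewrite (fubini_tonelli1 (abse \o (f \o @cons_rV R n)))//=.
apply: measurableT_comp => //; apply: measurableT_comp => //.
exact: measurable_cons_rV.
Qed.

Lemma integral_rVS n (f : 'rV[R]_n.+1 -> \bar R) :
  (lebesgue_rV n.+1).-integrable setT f ->
  (\int[lebesgue_rV n.+1]_x f x =
   \int[mu]_a \int[lebesgue_rV n]_y f (cons_rV (a, y)))%E.
Proof.
move=> fi; have := integrable_rVS fi; move/integrableP: fi => [mf _] fi.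
transitivity (\int[mu \x lebesgue_rV n]_w f (cons_rV w))%E.
  exact: (@integral_pushforward _ _ _ _ R _ (@measurable_cons_rV R n)
     (mu \x lebesgue_rV n)%E setT f mf).
by rewrite -(integral12_prod_meas1 fi).
Qed.

Lemma measurable_scale_rV n (c : R) :
  measurable_fun [set: 'rV[R]_n] (fun x : 'rV[R]_n => c *: x).
Proof.
apply: measurable_fun_rV => i; under eq_fun do rewrite mxE.
by apply: measurable_funM => //; exact: measurable_coord.
Qed.

Lemma cons_rV_scale n (c a : R) (y : 'rV[R]_n) :
  c *: cons_rV (a, y) = cons_rV (c * a, c *: y).
Proof.
apply/rowP => i; rewrite mxE; case: (unliftP ord0 i) => [j|] ->.
  by rewrite !cons_rVS/= mxE.
by rewrite !cons_rV0.
Qed.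

Lemma ge0_integral_rV_scale n (c : R) (f : 'rV[R]_n -> \bar R) : 0 < c ->
  measurable_fun setT f -> (forall x, 0 <= f x)%E ->
  (\int[lebesgue_rV n]_x f x =
   (c ^+ n)%:E * \int[lebesgue_rV n]_x f (c *: x)%R)%E.
Proof.
move=> c0; elim: n f => [|n IH] f mf f0.
  rewrite expr0 mul1e; apply: eq_integral => x _; congr f.
  by apply/rowP => -[].
have mcf : measurable_fun setT (fun x : 'rV[R]_n.+1 => f (c *: x)).
  by apply: measurableT_comp => //; exact: measurable_scale_rV.
have mF : measurable_fun setT (f \o @cons_rV R n).
  by apply: measurableT_comp => //; exact: measurable_cons_rV.
rewrite ge0_integral_rVS// [in RHS]ge0_integral_rVS//.
pose F a := (\int[lebesgue_rV n]_y f (cons_rV (a, y)))%E.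
have mG : measurable_fun setT F.
  exact: (@measurable_fun_fubini_tonelli_F _ _ _ _ _ (lebesgue_rV n) _ mF (fun w => f0 _)).
have F0 a : (0 <= F a)%E by exact: integral_ge0.
rewrite -[LHS]/(\int[mu]_a F a)%E.
rewrite (@ge0_integral_affine R c 0)//.
under eq_integral => a _.
  rewrite addr0 /F IH//; last first.
    by apply: measurableT_comp mF _; exact: pair1_measurable.
  under eq_integral do rewrite -cons_rV_scale.
  over.
rewrite ge0_integralZl//; last 3 first.
- exact: (measurable_fun_fubini_tonelli_F (fun w => f (c *: cons_rV w))
     (measurableT_comp mcf (@measurable_cons_rV R n))).
- by move=> x _; exact: integral_ge0.
- by rewrite lee_fin exprn_ge0// ltW.
by rewrite muleA -EFinM -exprS.
Qed.

Lemma integral_rV_scale n (c : R) (f : 'rV[R]_n -> \bar R) : 0 < c ->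
  measurable_fun setT f ->
  (\int[lebesgue_rV n]_x f x =
   (c ^+ n)%:E * \int[lebesgue_rV n]_x f (c *: x)%R)%E.
Proof.
move=> c0 mf; rewrite [LHS]integralE [in RHS]integralE.
rewrite (@ge0_integral_rV_scale n c f^\+%E)//; last exact: measurable_funepos.
rewrite (@ge0_integral_rV_scale n c f^\-%E)//; last exact: measurable_funeneg.
(* Both parts may have infinite integral, so distributivity is checked by cases; it survives because
   the factor is finite and positive. *)
have muleB0 (y z : \bar R) : (0 <= y)%E -> (0 <= z)%E ->
    ((c ^+ n)%:E * (y - z) = (c ^+ n)%:E * y - (c ^+ n)%:E * z)%E.
  have cn : (0 < (c ^+ n)%:E)%E by rewrite lte_fin exprn_gt0.
  move: y z => [y| |] [z| |]//= _ _; rewrite ?gt0_muley ?gt0_muleNy//.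
  by rewrite -!EFinM -!EFinB mulrBr.
rewrite -muleB0; last 2 first.
- by apply: integral_ge0 => x _.
- by apply: integral_ge0 => x _.
congr (_ * _)%E; congr (_ - _)%E; apply: eq_integral => x _.
- by rewrite ?funeposE.
- by rewrite ?funenegE.
Qed.

Lemma measurable_dot n (x : 'rV[R]_n) : measurable_fun setT (dot x).
Proof.
apply: measurable_sum => i; apply: measurable_funM => //.
exact: measurable_coord.
Qed.

Lemma measurable_enorm n : measurable_fun setT (@enorm R n).
Proof.
apply: measurableT_comp.
  by apply: continuous_measurable_fun; exact: sqrt_continuous.
apply: measurable_sum => i; apply: measurable_funM; exact: measurable_coord.
Qed.

End integral_rV.

(** * Bounds on cosine and on stretched exponentials *)

Section elementary_bounds.
Context {R : realType}.
Implicit Types x y c r : R.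

Lemma normr_sin_le x : `|sin x| <= `|x|.
Proof.
wlog x0 : x / 0 < x.
  move=> H; case: (ltgtP x 0) => [x0|/H//|->]; last by rewrite sin0.
  by rewrite -[sin x]opprK -sinN normrN -[in leRHS]normrN H// oppr_gt0.
have [|c _] := @MVT R sin cos 0 x x0 (fun u _ => is_derive_sin u).
  by apply: continuous_subspaceT; exact: continuous_sin.
rewrite sin0 !subr0 => ->; rewrite normrM -[leRHS]mul1r ler_wpM2r//.
exact: cos_max.
Qed.

Lemma cos_ge_quadratic x : 1 - x ^+ 2 / 2 <= cos x.
Proof.
have -> : cos x = 1 - 2 * sin (x / 2) ^+ 2.
  rewrite {1}[x]splitr cosD -!expr2 cos2sin2; ring.
have : sin (x / 2) ^+ 2 <= (x / 2) ^+ 2.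
  by rewrite -[leLHS]real_normK ?num_real// -[leRHS]real_normK ?num_real//
     lerXn2r ?nnegrE// normr_sin_le.
lra.
Qed.

Lemma exprn_le_expR n c y : 0 < c -> 0 <= y ->
  y ^+ n.+1 <= n.+1`!%:R / c ^+ n.+1 * expR (c * y).
Proof.
move=> c0 y0; have := @expR_ge1Dxn R (c * y) n (mulr_ge0 (ltW c0) y0).
rewrite exprMn => H.
have f0 : 0 < n.+1`!%:R :> R by rewrite ltr0n fact_gt0.
rewrite mulrAC ler_pdivlMr ?exprn_gt0// mulrC -ler_pdivrMl//.
by apply: le_trans _ H; rewrite [leLHS]mulrC (mulrC (c ^+ _)) lerDr ler01.
Qed.

(** For [r <= 1] the left side is at most 2^m. For [r > 1] it is at most 2^m times a power of
    r^theta, with exponent [k * m] where [theta * k >= 2], and the exponential series dominates that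
    power. The constant adds up both cases. *)
Lemma stretched_expR_bound (theta c : R) m : 0 < theta -> 0 < c ->
  exists2 C : R, 0 <= C & forall r, 0 <= r ->
    (1 + r ^+ 2) ^+ m <= C * expR (c * r `^ theta).
Proof.
move=> th0 c0.
have [k kth] : exists k : nat, 2 <= theta * k%:R.
  exists (Num.truncn (2 / theta)).+1.
  by rewrite mulrC -ler_pdivrMr// ltW// truncnS_gt.
pose M := (k * m)%N.
exists (2 ^+ m * (1 + M.+1`!%:R / c ^+ M.+1)) => [|r r0].
  by rewrite mulr_ge0 ?exprn_ge0// addr_ge0// divr_ge0// exprn_ge0// ltW.
have y0 : 0 <= r `^ theta by exact: powR_ge0.
have e1 : 1 <= expR (c * r `^ theta).
  by rewrite -expR0 ler_expR mulr_ge0// ltW.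
have f0 : 0 <= M.+1`!%:R / c ^+ M.+1 by rewrite divr_ge0// exprn_ge0// ltW.
have [r1|r1] := leP r 1.
  apply: (@le_trans _ _ (2 ^+ m)).
    rewrite lerXn2r ?nnegrE ?addr_ge0 ?sqr_ge0//.
    by rewrite -[leRHS]/(1 + 1) lerD2l exprn_ile1.
  rewrite -mulrA ler_peMr ?exprn_ge0//.
  by rewrite -[leLHS]mulr1 ler_pM// lerDl.
have rt1 : 1 <= r `^ theta by rewrite -(powRr0 r) ler_powR ?ltW.
apply: (@le_trans _ _ (2 ^+ m * (r `^ theta) ^+ M.+1)).
  apply: (@le_trans _ _ (2 ^+ m * (r `^ theta) ^+ M)); last first.
    by rewrite ler_wpM2l ?exprn_ge0// ler_weXn2l.
  rewrite /M exprM -exprMn lerXn2r ?nnegrE ?addr_ge0 ?mulr_ge0 ?sqr_ge0 ?exprn_ge0//.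
  have : r ^+ 2 <= (r `^ theta) ^+ k.
    rewrite -!powR_mulrn// -powRrM.
    by rewrite ler_powR// ltW.
  have : 1 <= r ^+ 2 by rewrite exprn_ege1// ltW.
  lra.
rewrite -mulrA ler_wpM2l ?exprn_ge0//.
apply: le_trans (exprn_le_expR _ c0 y0) _.
by rewrite ler_wpM2r ?expR_ge0// lerDr.
Qed.

End elementary_bounds.

(** * An integrable majorant on R^n *)

Section weight.
Context {R : realType}.
Notation mu := (@lebesgue_measure R).

Lemma measurable_oneDsqrV : measurable_fun setT (fun x : R => (oneDsqr x)^-1).
Proof. by apply: continuous_measurable_fun; exact: continuous_oneDsqrV. Qed.

Lemma integrable_oneDsqrV :
  mu.-integrable setT (fun x => ((oneDsqr x)^-1)%:E).
Proof.
have mf : measurable_fun setT (fun x : R => ((oneDsqr x)^-1)%:E).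
  by apply/measurable_EFinP; exact: measurable_oneDsqrV.
have f0 (x : R) : (0 <= ((oneDsqr x)^-1)%:E)%E.
  by rewrite lee_fin invr_ge0 (le_trans ler01)// oneDsqr_ge1.
apply/integrableP; split => //.
under eq_integral do rewrite gee0_abs//.
rewrite -(setUv `[0, +oo[%classic) ge0_integral_setU//=; last 3 first.
- exact: measurableC.
- by rewrite setUv.
- by apply/disj_setPCl.
apply: lte_add_pinfty; first by rewrite integral0y_oneDsqr ltry.
apply: (@le_lt_trans _ _ (\int[mu]_(x in `]-oo, 0%R]) ((oneDsqr x)^-1)%:E)%E).
  apply: ge0_subset_integral => //; first exact: measurableC.
    exact: measurable_funTS.
  by rewrite setCitvr; apply: subset_itvl; rewrite bnd_simp.
rewrite (_ : (\int[mu]_(x in _) _ = (pi / 2)%:E)%E) ?ltry//.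
rewrite -integral0y_oneDsqr ge0_integration_by_substitution0//.
by apply: eq_integral => x _; rewrite /oneDsqr sqrrN.
Qed.

(** Up to normalization, the product Cauchy density. It factors over the coordinates, so its
    integrability reduces to the arctangent integral. *)
Definition weight n (xi : 'rV[R]_n) : R := \prod_(i < n) (oneDsqr (xi 0 i))^-1.

Lemma oneDsqr_gt0 (x : R) : 0 < oneDsqr x.
Proof. by rewrite (lt_le_trans ltr01)// oneDsqr_ge1. Qed.

Lemma weight_ge0 n (xi : 'rV[R]_n) : 0 <= weight xi.
Proof. by apply: prodr_ge0 => i _; rewrite invr_ge0 ltW// oneDsqr_gt0. Qed.

Lemma measurable_weight n : measurable_fun setT (@weight n).
Proof.
apply: measurable_prod => i _.
exact: (measurableT_comp measurable_oneDsqrV (measurable_coord i)).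
Qed.

Lemma weight_cons n a (y : 'rV[R]_n) :
  weight (cons_rV (a, y)) = (oneDsqr a)^-1 * weight y.
Proof.
rewrite /weight big_ord_recl cons_rV0; congr (_ * _).
by apply: eq_bigr => i _; rewrite cons_rVS.
Qed.

Lemma integrable_weight n :
  (lebesgue_rV n).-integrable setT (fun xi : 'rV[R]_n => (weight xi)%:E).
Proof.
have mW k : measurable_fun setT (fun xi : 'rV[R]_k => (weight xi)%:E).
  by apply/measurable_EFinP; exact: measurable_weight.
have W0 k (xi : 'rV[R]_k) : (0 <= (weight xi)%:E)%E by rewrite lee_fin weight_ge0.
suff H : (\int[lebesgue_rV n]_xi (weight xi)%:E < +oo)%E.
  apply/integrableP; split; first exact: mW.
  by under eq_integral do rewrite gee0_abs//.
elim: n => [|n IH].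
  rewrite /= integral_dirac//; last exact: mW.
  rewrite diracT mul1e.
  by rewrite /weight big_ord0 ltry.
have E (a : R) : (\int[lebesgue_rV n]_y (weight (cons_rV (a, y)))%:E =
    ((oneDsqr a)^-1)%:E * \int[lebesgue_rV n]_y (weight y)%:E)%E.
  under eq_integral do rewrite weight_cons EFinM.
  by rewrite ge0_integralZl//=; exact: mW.
rewrite ge0_integral_rVS//; under eq_integral do rewrite E.
rewrite ge0_integralZr//=; last 2 first.
- by apply/measurable_EFinP; exact: measurable_oneDsqrV.
- by apply: integral_ge0 => y _; exact: W0.
rewrite lte_mul_pinfty//.
- by apply: integral_ge0 => x _; rewrite lee_fin invr_ge0 ltW// oneDsqr_gt0.
- exact: integrable_fin_num integrable_oneDsqrV.
Qed.

Lemma le_weight_integrable n (C : R) (f : 'rV[R]_n -> R) :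
  measurable_fun setT f -> (forall xi, `|f xi| <= C * weight xi) ->
  (lebesgue_rV n).-integrable setT (EFin \o f).
Proof.
move=> mf fC; apply: (@le_integrable _ _ _ _ setT _ _ (fun xi => C%:E * (weight xi)%:E)%E) => //.
- exact/measurable_EFinP.
- by move=> xi _; rewrite lee_fin (le_trans (fC xi))// ler_norm.
- exact: integrableZl (integrable_weight n).
Qed.

Lemma dot_ge0 n (xi : 'rV[R]_n) : 0 <= dot xi xi.
Proof. by apply: sumr_ge0 => i _; rewrite -expr2 sqr_ge0. Qed.

Lemma enorm_sqr n (xi : 'rV[R]_n) : enorm xi ^+ 2 = dot xi xi.
Proof. by rewrite /enorm sqr_sqrtr// dot_ge0. Qed.

Lemma weight_ge n (xi : 'rV[R]_n) : ((1 + dot xi xi) ^+ n)^-1 <= weight xi.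
Proof.
have -> : ((1 + dot xi xi) ^+ n)^-1 = \prod_(i < n) (1 + dot xi xi)^-1.
  by rewrite prodr_const card_ord exprVn.
apply: ler_prod => i _.
rewrite invr_ge0 addr_ge0 ?dot_ge0//= lef_pV2 ?posrE ?oneDsqr_gt0//; last first.
  by rewrite ltr_pwDl// dot_ge0.
rewrite lerD2l /dot (bigD1 i)//= -expr2 lerDl.
by apply: sumr_ge0 => j _; rewrite -expr2 sqr_ge0.
Qed.

(** Of the [n.+1] powers of 1 + |xi|^2 absorbed by the exponential, [n] pay for the weight; the
    remaining one makes the second moment finite as well. *)
Lemma stretched_expR_le_weight n (theta c : R) : 0 < theta -> 0 < c ->
  exists2 C : R, 0 <= C & forall xi : 'rV[R]_n,
    (1 + dot xi xi) * expR (- (c * enorm xi `^ theta)) <= C * weight xi.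
Proof.
move=> th0 c0; have [C C0 HC] := @stretched_expR_bound R theta c n.+1 th0 c0.
exists C => // xi.
apply: (@le_trans _ _ (C * ((1 + dot xi xi) ^+ n)^-1)); last first.
  by rewrite ler_wpM2l// weight_ge.
have d0 : 0 < 1 + dot xi xi by rewrite ltr_pwDl// dot_ge0.
rewrite ler_pdivlMr ?exprn_gt0// expRN mulrAC ler_pdivrMr ?expR_gt0//.
rewrite -exprS -enorm_sqr; apply: HC.
exact: sqrtr_ge0.
Qed.

End weight.

(** * The Fourier transform of a Gaussian in dimension one *)

Section gaussian_dim1.
Context {R : realType}.
Notation mu := (@lebesgue_measure R).
Implicit Types a x u v : R.

Lemma measurable_gaussian1 a : measurable_fun setT (fun u : R => expR (- (a * u ^+ 2))).
Proof.
apply: measurableT_comp => //; apply: measurableT_comp => //.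
by apply: measurable_funM => //; exact: measurable_funX.
Qed.

Lemma measurable_cosM x : measurable_fun setT (fun u : R => cos (x * u)).
Proof.
apply: (measurableT_comp (f := @cos R)); last exact: measurable_funM.
by apply: continuous_measurable_fun; exact: continuous_cos.
Qed.

Lemma measurable_sinM x : measurable_fun setT (fun u : R => sin (x * u)).
Proof.
apply: (measurableT_comp (f := @sin R)); last exact: measurable_funM.
by apply: continuous_measurable_fun; exact: continuous_sin.
Qed.

Lemma integrable_gaussian1 a : 0 < a ->
  mu.-integrable setT (EFin \o (fun u => expR (- (a * u ^+ 2)))).
Proof.
move=> a0; have [C C0 HC] := @stretched_expR_bound R 2 a 1 (ltr0Sn R 1) a0.
apply: le_integrable (integrableZl measurableT C integrable_oneDsqrV) => //.
- by apply/measurable_EFinP; exact: measurable_gaussian1.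
- move=> u _; rewrite lee_fin.
  rewrite (ger0_norm (expR_ge0 _)) ger0_norm; last first.
    by rewrite mulr_ge0// invr_ge0 ltW// oneDsqr_gt0.
  rewrite ler_pdivlMr ?oneDsqr_gt0// expRN mulrC ler_pdivrMr ?expR_gt0//.
  have := HC `|u| (normr_ge0 u); rewrite expr1 -powR_mulrn//.
  by rewrite powR_mulrn// real_normK ?num_real.
Qed.

Lemma integrable_gaussian1M a (h : R -> R) : 0 < a ->
  measurable_fun setT h -> (forall u, `|h u| <= 1) ->
  mu.-integrable setT (EFin \o (fun u => expR (- (a * u ^+ 2)) * h u)).
Proof.
move=> a0 mh h1; apply: le_integrable (integrable_gaussian1 a0) => //.
  by apply/measurable_EFinP; apply: measurable_funM => //; exact: measurable_gaussian1.
by move=> u _; rewrite lee_fin normrM ler_piMr// h1.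
Qed.

Lemma integral_gaussian1_sin a x : 0 < a ->
  (\int[mu]_u (expR (- (a * u ^+ 2)) * sin (x * u))%:E = 0)%E.
Proof.
move=> a0; set f := fun u => (expR (- (a * u ^+ 2)) * sin (x * u))%:E.
have fi : mu.-integrable setT f.
  exact: (integrable_gaussian1M a0 (measurable_sinM x) (fun u => sin_max _)).
have : (\int[mu]_u f u = - \int[mu]_u f u)%E.
  rewrite -[LHS](integral_reflect (measurable_int _ fi)) -integralN.
    by apply: eq_integral => u _; rewrite /f sqrrN mulrN sinN mulrN EFinN.
  by apply: fin_num_adde_defl; rewrite fin_numN integrable_neg_fin_num.
rewrite -(fineK (integrable_fin_num _ fi))// -EFinN => -[] H; congr EFin.
by move: H; lra.
Qed.

Lemma integral_gaussian1_gt0 a : 0 < a ->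
  (0 < \int[mu]_u (expR (- (a * u ^+ 2)))%:E)%E.
Proof.
move=> a0; apply: (@lt_le_trans _ _ (expR (- a))%:E); first by rewrite lte_fin expR_gt0.
rewrite -[leLHS]mule1 -(_ : mu `[0, 1]%classic = 1%E); last first.
  by rewrite lebesgue_measure_itv/= lte_fin ltr01 -EFinB subr0.
rewrite -integral_cst// integral_mkcond; apply: ge0_le_integral_nomeas => u _ /=.
  by rewrite patchE; case: ifPn => // _; rewrite lee_fin expR_ge0.
rewrite patchE; case: ifPn => [|_]; last by rewrite lee_fin expR_ge0.
rewrite inE/= in_itv/= => /andP[u0 u1]; rewrite lee_fin ler_expR lerN2.
by rewrite ler_piMr ?exprn_ile1// ltW.
Qed.

(* By completing the square, the square of the transform of exp(-2au^2) is the
   transform of exp(-au^2) times a positive Gaussian integral. *)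
Lemma integral_gaussian1_cos_ge0 a x : 0 < a ->
  (0 <= \int[mu]_u (expR (- (a * u ^+ 2)) * cos (x * u))%:E)%E.
Proof.
move=> a0; pose b := 2 * a; have b0 : 0 < b by rewrite mulr_gt0.
have b20 : 0 < 2 * b by rewrite mulr_gt0.
pose g u := expR (- (b * u ^+ 2)).
have ci y := integrable_gaussian1M b0 (measurable_cosM y) (fun u => cos_max _).
have si y := integrable_gaussian1M b0 (measurable_sinM y) (fun u => sin_max _).
pose J := (\int[mu]_u (g u * cos (x * u))%:E)%E.
have Jfin : J \is a fin_num by exact: integrable_fin_num (ci x).
pose G := (\int[mu]_u (expR (- (2 * b * u ^+ 2)))%:E)%E.
have Gfin : G \is a fin_num by exact: integrable_fin_num (integrable_gaussian1 b20).
pose F (u v : R) := (g u * g v * cos (x * (u + v)))%:E.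
(* The addition formula splits [cos (x * (u + v))]; its sine part integrates to zero by oddness, so
   the double integral of [F] is [J * J]. *)
have EF u : (\int[mu]_v F u v = J * (g u * cos (x * u))%:E)%E.
  transitivity (\int[mu]_v ((g u * cos (x * u))%:E * (g v * cos (x * v))%:E
      - (g u * sin (x * u))%:E * (g v * sin (x * v))%:E))%E.
    apply: eq_integral => v _; rewrite /F mulrDr cosD -!EFinM -EFinB; congr EFin.
    ring.
  rewrite integralB//; last 2 first.
  - exact: integrableZl (ci x).
  - exact: integrableZl (si x).
  rewrite !integralZl//; [|exact: si|exact: ci].
  by rewrite (integral_gaussian1_sin x b0) mule0 sube0 muleC.
have JJ : (J * J = \int[mu]_u \int[mu]_v F u v)%E.
  under eq_integral do rewrite EF -(fineK Jfin).
  by rewrite integralZl ?fineK//; exact: ci.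
(* This is [F] in the coordinates (u, u + v): u^2 + (v - u)^2 = v^2 / 2 + 2 (u - v / 2)^2, and
   [b = 2 * a] turns b v^2 / 2 into a v^2. *)
pose H (w : measurableTypeR R * measurableTypeR R) :=
  (expR (- (a * w.2 ^+ 2)) * cos (x * w.2)
   * expR (- (2 * b * (w.1 - w.2 / 2) ^+ 2)))%:E.
have FH u : (\int[mu]_v F u v = \int[mu]_v H (u, v))%E.
  have mF : measurable_fun setT (F u).
    apply/measurable_EFinP; apply: measurable_funM.
      by apply: measurable_funM => //; exact: measurable_gaussian1.
    apply: (measurableT_comp (measurable_cosM x)).
    exact: measurable_funD.
  rewrite -[LHS](integral_translate (- u) mF).
  apply: eq_integral => v _; rewrite /F /H /g/=; congr EFin.
  rewrite (_ : u + (v - u) = v); last by ring.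
  rewrite -expRD [RHS]mulrAC -expRD; congr (expR _ * _).
  by rewrite /b; field.
have shift (c v : R) :
    (\int[mu]_u (c * expR (- (2 * b * (u - v / 2) ^+ 2)))%:E = c%:E * G)%E.
  rewrite -(integralZl measurableT (integrable_gaussian1 b20)).
  have mf : measurable_fun setT
      (fun u : R => c%:E * (expR (- (2 * b * u ^+ 2)))%:E)%E.
    apply: emeasurable_funM => //.
    by apply/measurable_EFinP; exact: measurable_gaussian1.
  by rewrite -[RHS](integral_translate (- (v / 2)) mf).
pose h v := expR (- (a * v ^+ 2)) * cos (x * v).
have hi : mu.-integrable setT (EFin \o h).
  exact: (integrable_gaussian1M a0 (measurable_cosM x) (fun u => cos_max _)).
have mH : measurable_fun setT H.
  apply/measurable_EFinP; apply: measurable_funM.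
    apply: (measurableT_comp (f := h)); last exact: measurable_snd.
    by apply/measurable_EFinP; exact: measurable_int hi.
  apply: (measurableT_comp (measurable_gaussian1 (2 * b))).
  apply: measurable_funB; first exact: measurable_fst.
  by apply: measurable_funM => //; exact: measurable_snd.
have Hi : (mu \x mu)%E.-integrable setT H.
  apply/(integrable21ltyP mu mu mH).
  under eq_integral => v _.
    under eq_integral do rewrite /H/= normrM (ger0_norm (expR_ge0 _)).
    rewrite shift.
    over.
  have /integrableP[_] := integrableZr measurableT (fine G) (integrable_norm hi).
  apply: le_lt_trans; rewrite le_eqVlt; apply/orP; left; apply/eqP.
  apply: eq_integral => v _; rewrite /comp /cst (fineK Gfin) gee0_abs// mule_ge0//.
  exact: ltW (integral_gaussian1_gt0 b20).
have E : (J * J = (\int[mu]_v (h v)%:E) * G)%E.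
  rewrite JJ; under eq_integral do rewrite FH.
  rewrite (Fubini Hi) -(fineK Gfin) -integralZr//.
  by apply: eq_integral => v _; rewrite fineK// -(shift _ v).
have := integral_gaussian1_gt0 b20; rewrite -/G -(fineK Gfin) lte_fin => G0.
have := sqr_ge0 (fine J).
rewrite -[(_ <= _)%E]/(0 <= \int[mu]_v (h v)%:E)%E.
have hfin := integrable_fin_num measurableT hi.
move: E; rewrite -(fineK Jfin) -(fineK Gfin) -(fineK hfin) -!EFinM => -[E].
by rewrite expr2 E pmulr_lge0// lee_fin.
Qed.

End gaussian_dim1.

(** * The Fourier transform of a Gaussian in R^n *)

Section gaussian_rV.
Context {R : realType}.
Notation mu := (@lebesgue_measure R).

Definition gaussian n (a : R) (xi : 'rV[R]_n) : R := expR (- (a * dot xi xi)).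

Lemma measurable_dotxx n : measurable_fun setT (fun xi : 'rV[R]_n => dot xi xi).
Proof. by apply: measurable_sum => i; apply: measurable_funM; exact: measurable_coord. Qed.

Lemma measurable_gaussian n a : measurable_fun setT (@gaussian n a).
Proof.
apply: measurableT_comp => //; apply: measurableT_comp => //.
by apply: measurable_funM => //; exact: measurable_dotxx.
Qed.

Lemma measurable_cos_dot n (x : 'rV[R]_n) : measurable_fun setT (fun xi => cos (dot x xi)).
Proof.
apply: (measurableT_comp (f := @cos R)); last exact: measurable_dot.
by apply: continuous_measurable_fun; exact: continuous_cos.
Qed.

Lemma measurable_sin_dot n (x : 'rV[R]_n) : measurable_fun setT (fun xi => sin (dot x xi)).
Proof.
apply: (measurableT_comp (f := @sin R)); last exact: measurable_dot.
by apply: continuous_measurable_fun; exact: continuous_sin.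
Qed.

Lemma integrable_gaussianM n a (M : R) (h : 'rV[R]_n -> R) : 0 < a ->
  measurable_fun setT h -> (forall xi, `|h xi| <= M) ->
  (lebesgue_rV n).-integrable setT (EFin \o (fun xi => gaussian a xi * h xi)).
Proof.
move=> a0 mh hM.
have [C C0 HC] := @stretched_expR_le_weight R n 2 a (ltr0Sn R 1) a0.
apply: (@le_weight_integrable _ _ (C * M)).
  by apply: measurable_funM => //; exact: measurable_gaussian.
move=> xi; rewrite normrM mulrAC ler_pM// ger0_norm ?expR_ge0//.
apply: le_trans (HC xi); rewrite powR_mulrn ?sqrtr_ge0// enorm_sqr.
by rewrite ler_peMl ?expR_ge0// lerDl dot_ge0.
Qed.

Definition tail_rV n (x : 'rV[R]_n.+1) : 'rV[R]_n := \row_i x 0 (lift ord0 i).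

Lemma dot_cons n (x : 'rV[R]_n.+1) a (y : 'rV[R]_n) :
  dot x (cons_rV (a, y)) = x 0 ord0 * a + dot (tail_rV x) y.
Proof.
rewrite /dot big_ord_recl cons_rV0; congr (_ + _).
by apply: eq_bigr => i _; rewrite cons_rVS mxE.
Qed.

Lemma gaussian_cons n a u (y : 'rV[R]_n) :
  gaussian a (cons_rV (u, y)) = expR (- (a * u ^+ 2)) * gaussian a y.
Proof.
rewrite /gaussian dot_cons cons_rV0 -expRD mulrDr opprD -expr2; congr (expR (_ - _ * _)).
by congr dot; apply/rowP => i; rewrite mxE cons_rVS.
Qed.

(** The sine integral is carried through the induction because the addition formulas mix it with the
    cosine one. Terms with a sine of the tail vanish by induction; in the sine integral, the other
    term vanishes by oddness in the first coordinate. *)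
Lemma integral_gaussian_cos_sin n a (x : 'rV[R]_n) : 0 < a ->
  ((0 <= \int[lebesgue_rV n]_xi (gaussian a xi * cos (dot x xi))%:E) /\
  (\int[lebesgue_rV n]_xi (gaussian a xi * sin (dot x xi))%:E = 0))%E.
Proof.
move=> a0.
have ci k (y : 'rV[R]_k) :=
  integrable_gaussianM a0 (measurable_cos_dot y) (fun u => cos_max _).
have si k (y : 'rV[R]_k) :=
  integrable_gaussianM a0 (measurable_sin_dot y) (fun u => sin_max _).
elim: n x => [|n IH] x.
  rewrite /= !integral_dirac//; last 2 first.
  - exact: measurable_int (si _ _).
  - exact: measurable_int (ci _ _).
  rewrite diracT !mul1e /dot big_ord0 cos0 sin0 mulr0 mulr1.
  by rewrite lee_fin expR_ge0.
have [C0 S0] := IH (tail_rV x).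
set Cn := (\int[lebesgue_rV n]_xi _)%E in C0.
have Cfin : Cn \is a fin_num by exact: integrable_fin_num (ci _ _).
have c1 := integrable_gaussian1M a0 (measurable_cosM (x 0 ord0)) (fun u => cos_max _).
have s1 := integrable_gaussian1M a0 (measurable_sinM (x 0 ord0)) (fun u => sin_max _).
have inner (k l u : R) :
  (\int[lebesgue_rV n]_y (k * (gaussian a y * cos (dot (tail_rV x) y)) +
     l * (gaussian a y * sin (dot (tail_rV x) y)))%:E = k%:E * Cn)%E.
  under eq_integral do rewrite EFinD !EFinM.
  rewrite integralD//; [|exact: integrableZl (ci _ _)|exact: integrableZl (si _ _)].
  rewrite !integralZl//; [|exact: si|exact: ci].
  by rewrite S0 mule0 adde0.
rewrite !integral_rVS; [|exact: si|exact: ci].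
split.
  rewrite (_ : (\int[mu]_u _ = \int[mu]_u
      ((expR (- (a * u ^+ 2)) * cos (x 0 ord0 * u))%:E * Cn))%E); last first.
    apply: eq_integral => u _.
    rewrite -(inner _ (- (expR (- (a * u ^+ 2)) * sin (x 0 ord0 * u))))//.
    apply: eq_integral => y _; congr EFin.
    rewrite dot_cons cosD gaussian_cons; ring.
  rewrite -(fineK Cfin) integralZr// mule_ge0//.
    exact: integral_gaussian1_cos_ge0.
  by rewrite fineK.
rewrite (_ : (\int[mu]_u _ = \int[mu]_u
    ((expR (- (a * u ^+ 2)) * sin (x 0 ord0 * u))%:E * Cn))%E); last first.
  apply: eq_integral => u _.
  rewrite -(inner _ (expR (- (a * u ^+ 2)) * cos (x 0 ord0 * u)))//.
  apply: eq_integral => y _; congr EFin.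
  rewrite dot_cons sinD gaussian_cons; ring.
by rewrite -(fineK Cfin) integralZr// integral_gaussian1_sin// mul0e.
Qed.

End gaussian_rV.

Lemma measurable_funexpRN d (T : measurableType d) (R : realType) (D : set T)
    (f : T -> R) :
  measurable_fun D f -> measurable_fun D (fun x => expR (- f x)).
Proof.
by move=> mf; apply: measurableT_comp => //; exact: measurableT_comp.
Qed.

(** * Positive definite radial functions *)

Section positive_definite.
Context {R : realType} (n : nat).
Notation nng := (`[0%R, +oo[%classic : set R).
Implicit Types (phi g : R -> R) (l s c : R).

(* Positive definiteness of the radial function phi (|xi|^2), tested against
   all Gaussians to avoid integrability issues. *)
Definition posdef phi :=
  [/\ measurable_fun nng phi,
      exists M : R, forall l, 0 <= l -> `|phi l| <= M &
      forall a (x : 'rV[R]_n), 0 < a ->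
        (0 <= \int[lebesgue_rV n]_xi
          (gaussian a xi * (phi (dot xi xi) * cos (dot x xi)))%:E)%E].

Lemma measurable_radial phi (x : 'rV[R]_n) : measurable_fun nng phi ->
  measurable_fun setT (fun xi : 'rV[R]_n => phi (dot xi xi) * cos (dot x xi)).
Proof.
move=> mphi; apply: measurable_funM; last exact: measurable_cos_dot.
apply: (measurable_comp (F := nng)) mphi (@measurable_dotxx R n) => //.
by move=> _ [xi _ <-] /=; rewrite in_itv/= dot_ge0.
Qed.

Lemma radial_le phi (M : R) (x xi : 'rV[R]_n) :
  (forall l, 0 <= l -> `|phi l| <= M) -> `|phi (dot xi xi) * cos (dot x xi)| <= M.
Proof.
move=> H; rewrite normrM (le_trans _ (H _ (dot_ge0 xi)))//.
by rewrite ler_piMr// cos_max.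
Qed.

Lemma integrable_radial a phi (M : R) (x : 'rV[R]_n) : 0 < a ->
  measurable_fun nng phi -> (forall l, 0 <= l -> `|phi l| <= M) ->
  (lebesgue_rV n).-integrable setT
    (EFin \o (fun xi => gaussian a xi * (phi (dot xi xi) * cos (dot x xi)))).
Proof.
move=> a0 mphi H; apply: (@integrable_gaussianM _ _ _ M) => //.
  exact: measurable_radial.
by move=> xi; exact: radial_le.
Qed.

Lemma posdef1 : posdef (fun=> 1).
Proof.
split=> //; first by exists 1 => l _; rewrite normr1.
by move=> a x a0; under eq_integral do rewrite mul1r; have [] := integral_gaussian_cos_sin x a0.
Qed.

Lemma eq_posdef phi psi : phi =1 psi -> posdef phi -> posdef psi.
Proof. by move=> /funext ->. Qed.

Lemma posdefD phi psi : posdef phi -> posdef psi -> posdef (fun l => phi l + psi l).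
Proof.
move=> [mp [M HM] p0] [mq [M' HM'] q0]; split=> [||a x a0].
- exact: measurable_funD.
- exists (M + M') => l l0; rewrite (le_trans (ler_normD _ _))// lerD ?HM ?HM'//.
under eq_integral do rewrite mulrDl mulrDr EFinD.
rewrite integralD//; [|exact: integrable_radial HM|exact: integrable_radial HM'].
by rewrite adde_ge0 ?p0 ?q0.
Qed.

Lemma posdefZ c phi : 0 <= c -> posdef phi -> posdef (fun l => c * phi l).
Proof.
move=> c0 [mp [M HM] p0]; split=> [||a x a0].
- exact: measurable_funM.
- by exists (c * M) => l l0; rewrite normrM ger0_norm// ler_wpM2l// HM.
under eq_integral do rewrite -mulrA mulrCA EFinM.
rewrite integralZl//; last exact: integrable_radial HM.
by rewrite mule_ge0// p0.
Qed.

Lemma posdef_sum (F : nat -> R -> R) K : (forall k, posdef (F k)) ->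
  posdef (fun l => \sum_(0 <= k < K) F k l).
Proof.
move=> HF; elim: K => [|K IH].
  apply: (@eq_posdef (fun l => 0 * 1)); last exact: posdefZ posdef1.
  by move=> l; rewrite big_geq// mul0r.
apply: eq_posdef (posdefD IH (HF K)) => l.
by rewrite big_nat_recr.
Qed.

(** The exponential merges with the test Gaussian, whose parameter becomes [a + s]. *)
Lemma posdef_expR s phi : 0 <= s -> posdef phi ->
  posdef (fun l => expR (- (s * l)) * phi l).
Proof.
move=> s0 [mp [M HM] p0]; split=> [||a x a0].
- apply: measurable_funM => //; apply: measurable_funexpRN.
  exact: measurable_funM.
- exists M => l l0; rewrite normrM (le_trans _ (HM _ l0))// ler_piMl//.
  by rewrite ger0_norm ?expR_ge0// -expR0 ler_expR oppr_le0 mulr_ge0.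
under eq_integral => xi _.
  rewrite -mulrA mulrA /gaussian -expRD -opprD -mulrDl.
  over.
by apply: p0; rewrite ltr_pwDl.
Qed.

(** Dominated convergence applies for each test Gaussian, since [M] times that Gaussian is a
    majorant common to all [k]. *)
Lemma posdef_lim (F : nat -> R -> R) phi (M : R) :
  (forall k, posdef (F k)) ->
  (forall k l, 0 <= l -> `|F k l| <= M) ->
  (forall l, 0 <= l -> F ^~ l @ \oo --> phi l) -> posdef phi.
Proof.
move=> HF FM Fphi.
have mphi : measurable_fun nng phi.
  apply: (measurable_fun_cvg (h := F)) => [k|l /=]; first by have [] := HF k.
  by rewrite in_itv/= andbT; exact: Fphi.
have phiM l : 0 <= l -> `|phi l| <= M.
  move=> l0; have /cvg_norm := Fphi l l0; move=> /(@cvg_lim _) H.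
  have Hc : cvg (`|F k l| @[k --> \oo]).
    by apply/cvg_ex; exists `|phi l|; exact: cvg_norm (Fphi l l0).
  by rewrite -(H (@norm_hausdorff _ _)); apply: limr_le => //; near=> k; exact: FM.
split=> // [|a x a0]; first by exists M.
pose f_ k xi := (gaussian a xi * (F k (dot xi xi) * cos (dot x xi)))%:E.
have mf_ k : measurable_fun setT (f_ k).
  have [mF _ _] := HF k.
  by apply: measurable_int; exact: (integrable_radial x a0 mF (FM k)).
have [] := @dominated_convergence _ _ _ (lebesgue_rV n) setT measurableT f_
  (fun xi => (gaussian a xi * (phi (dot xi xi) * cos (dot x xi)))%:E)
  (fun xi => (gaussian a xi * M)%:E) mf_.
- by apply: measurable_int; exact: (integrable_radial x a0 mphi phiM).
- apply: aeW => xi _; apply: cvg_EFin; first by near=> k.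
  apply: cvgM; first exact: cvg_cst.
  by apply: cvgM; [exact: Fphi (dot_ge0 xi)|exact: cvg_cst].
- apply: (@integrable_gaussianM _ _ _ `|M|) => //.
- apply: aeW => xi k _; rewrite lee_fin normrM (ger0_norm (expR_ge0 _)).
  by rewrite ler_wpM2l ?expR_ge0// radial_le//; exact: FM.
move=> _ _ cv; rewrite -(cvg_lim _ cv)//; apply: lime_ge.
  by apply/cvg_ex; eexists; exact: cv.
by near=> k; have [_ _ ->] := HF k.
Unshelve. all: by end_near. Qed.

End positive_definite.

(** * Negative definite exponents *)

Section negative_definite.
Context {R : realType} (n : nat).
Notation nng := (`[0%R, +oo[%classic : set R).
Implicit Types (phi g : R -> R) (l s c t : R).

(* The functions g such that exp(-tg) is a multiplier of the positive definite
   functions for all t >= 0; this class contains the Bernstein functions. *)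
Definition negdef g :=
  (forall l, 0 <= l -> 0 <= g l) /\
  (forall t phi, 0 <= t -> posdef n phi -> posdef n (fun l => expR (- (t * g l)) * phi l)).

Lemma negdef0 : negdef (fun=> 0).
Proof.
split=> // t phi t0; apply: eq_posdef => l.
by rewrite mulr0 oppr0 expR0 mul1r.
Qed.

Lemma negdef_id : negdef id.
Proof. by split=> // t phi t0; exact: posdef_expR. Qed.

Lemma negdefD g h : negdef g -> negdef h -> negdef (fun l => g l + h l).
Proof.
move=> [g0 Hg] [h0 Hh]; split=> [l l0|t phi t0 Hphi].
  by rewrite addr_ge0 ?g0 ?h0.
apply: eq_posdef (Hg _ _ t0 (Hh _ _ t0 Hphi)) => l /=.
by rewrite mulrDr opprD expRD mulrA.
Qed.

Lemma negdefZ c g : 0 <= c -> negdef g -> negdef (fun l => c * g l).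
Proof.
move=> c0 [g0 Hg]; split=> [l l0|t phi t0 Hphi]; first by rewrite mulr_ge0 ?g0.
by apply: eq_posdef (Hg (t * c) _ _ Hphi) => [l|]; rewrite ?mulrA ?mulr_ge0.
Qed.

Lemma negdef_sum (F : nat -> R -> R) K : (forall k, negdef (F k)) ->
  negdef (fun l => \sum_(0 <= k < K) F k l).
Proof.
move=> HF; elim: K => [|K IH].
  by rewrite (_ : (fun _ => _) = fun=> 0); [exact: negdef0|apply/funext => l; rewrite big_geq].
rewrite (_ : (fun _ => _) = fun l => \sum_(0 <= k < K) F k l + F K l); first exact: negdefD.
by apply/funext => l; rewrite big_nat_recr.
Qed.

Lemma negdef_lim (F : nat -> R -> R) g :
  (forall k, negdef (F k)) ->
  (forall l, 0 <= l -> F ^~ l @ \oo --> g l) -> negdef g.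
Proof.
move=> HF Fg; split=> [l l0|t phi t0 Hphi].
  have H : cvgn (F ^~ l) by apply/cvg_ex; exists (g l); exact: Fg.
  rewrite -(cvg_lim (@Rhausdorff R) (Fg l l0)); apply: limr_ge => //.
  by near=> k; have [->] := HF k.
have [mphi [M HM] _] := Hphi.
apply: (@posdef_lim R n (fun k l => expR (- (t * F k l)) * phi l) _ M).
- by move=> k; have [_] := HF k; exact.
- move=> k l l0; rewrite normrM (le_trans _ (HM _ l0))// ler_piMl//.
  rewrite ger0_norm ?expR_ge0// -expR0 ler_expR oppr_le0 mulr_ge0//.
  by have [->] := HF k.
- move=> l l0; apply: cvgM; last exact: cvg_cst.
  apply: continuous_cvg; first exact: continuous_expR.
  by apply: cvgN; apply: cvgM; [exact: cvg_cst|exact: Fg].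
Unshelve. all: by end_near. Qed.

Lemma negdef_atom c s : 0 <= c -> 0 <= s ->
  negdef (fun l => c * (1 - expR (- (s * l)))).
Proof.
move=> c0 s0; apply: negdefZ => //; split=> [l l0|t phi t0 Hphi].
  by rewrite subr_ge0 -expR0 ler_expR oppr_le0 mulr_ge0.
have [mphi [M HM] _] := Hphi.
pose F K l := expR (- t) * (\sum_(0 <= k < K)
   (t ^+ k / k`!%:R) * (expR (- (k%:R * s * l)) * phi l)).
have FE K l : F K l = expR (- t) * series (exp_coeff (t * expR (- (s * l)))) K * phi l.
  rewrite /F -mulrA /series/= mulr_suml; congr (_ * _); apply: eq_bigr => k _.
  rewrite /exp_coeff/= exprMn -expRM_natl.
  by rewrite (_ : k%:R * - (s * l) = - (k%:R * s * l)); ring.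
have sc y : series (exp_coeff y) @ \oo --> expR y by exact: is_cvg_series_exp_coeff.
apply: (@posdef_lim R n F _ M).
- move=> K; apply: posdefZ; first exact: expR_ge0.
  apply: posdef_sum => k; apply: posdefZ; first by rewrite divr_ge0// exprn_ge0.
  by apply: posdef_expR => //; rewrite mulr_ge0.
(* The partial sums increase to the exponential of [t * expR (- (s * l))], which is at most e^t; the
   prefactor e^(-t) compensates this, so the bound [M] of [phi] serves for all [K]. *)
- move=> K l l0; rewrite FE normrM (le_trans _ (HM _ l0))// ler_piMl//.
  have y0 : 0 <= t * expR (- (s * l)) by rewrite mulr_ge0 ?expR_ge0.
  rewrite ger0_norm; last first.
    by rewrite mulr_ge0 ?expR_ge0// sumr_ge0// => k _; exact: exp_coeff_ge0.
  rewrite expRN ler_pdivrMl ?expR_gt0// mulr1.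
  apply: (@le_trans _ _ (expR (t * expR (- (s * l))))).
    apply: nondecreasing_cvgn_le; last exact: is_cvg_series_exp_coeff.
    by apply: nondecreasing_series => k _ _; exact: exp_coeff_ge0.
  by rewrite ler_expR ler_piMr// -expR0 ler_expR oppr_le0 mulr_ge0.
- move=> l l0; under eq_fun do rewrite FE.
  rewrite mulrBr mulr1 opprB addrC expRD.
  by apply: cvgM; [apply: cvgM; [exact: cvg_cst|exact: sc]|exact: cvg_cst].
Qed.

End negative_definite.

(* The sum over k in Z of r^(alpha k) (1 - exp(-r^(-k) l)) is a discretization
   of the integral representation of l^alpha: it is alpha-homogeneous for
   dilations by powers of r, hence proportional to l^alpha in the limit r -> 1. *)
Section lattice_power.
Context {R : realType} (alpha r : R).
Hypotheses (alpha_gt0 : 0 < alpha) (alpha_lt1 : alpha < 1) (r_gt1 : 1 < r).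
Implicit Types (l x y : R) (k K : nat).

Let r_gt0 : 0 < r. Proof. exact: lt_trans r_gt1. Qed.

Let powD (u v : R) : r `^ (u + v) = r `^ u * r `^ v.
Proof. by rewrite powRD// (gt_eqF r_gt0) implybT. Qed.

Let powR_lt1 x : x < 0 -> r `^ x < 1.
Proof.
by move=> x0; rewrite /powR gt_eqF// -expR0 ltr_expR nmulr_rlt0// ln_gt0.
Qed.

Definition lattice_term y l : R :=
  r `^ (alpha * y) * (1 - expR (- (r `^ (- y) * l))).

Lemma lattice_term_ge0 y l : 0 <= l -> 0 <= lattice_term y l.
Proof.
move=> l0; rewrite mulr_ge0 ?powR_ge0// subr_ge0 -expR0 ler_expR oppr_le0.
by rewrite mulr_ge0 ?powR_ge0.
Qed.

Lemma le_lattice_term y l l' : l <= l' -> lattice_term y l <= lattice_term y l'.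
Proof.
move=> ll'; rewrite ler_wpM2l ?powR_ge0// lerD2l lerN2 ler_expR lerN2.
by rewrite ler_wpM2l ?powR_ge0.
Qed.

Lemma lattice_termM y l : lattice_term y (r * l) = r `^ alpha * lattice_term (y - 1) l.
Proof.
rewrite /lattice_term [RHS]mulrA -powD; congr (r `^ _ * (1 - expR (- _))).
  by ring.
by rewrite opprB addrC powD powRr1 ?ltW// mulrA.
Qed.

Definition lattice_up K l : R := \sum_(0 <= k < K) lattice_term k%:R l.

Definition lattice_down K l : R := \sum_(0 <= k < K) lattice_term (- k.+1%:R) l.

(** Dilation by [r] lowers every index by one, so the term of index 0 passes from the upper half to
    the lower half; hence the exchanged bounds [K] and [K.+1]. *)
Lemma lattice_shift K l : lattice_up K.+1 (r * l) + lattice_down K (r * l) =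
  r `^ alpha * (lattice_up K l + lattice_down K.+1 l).
Proof.
rewrite /lattice_up /lattice_down !big_nat_recl//.
rewrite [in RHS]addrCA addrA !mulrDr !mulr_sumr lattice_termM sub0r.
congr (_ + _ + _); apply: eq_big_nat => k _; rewrite lattice_termM.
  by congr (_ * lattice_term _ _); rewrite -natr1 addrK.
by congr (_ * lattice_term _ _); rewrite -[in RHS]natr1 opprD.
Qed.

(** Here 1 - exp(-v) <= v gives a geometric majorant of ratio r^(alpha - 1), which is below 1
    because [alpha < 1]. *)
Lemma cvg_lattice_up l : 0 <= l -> cvgn (lattice_up ^~ l).
Proof.
move=> l0; apply: (@series_le_cvg R _ (geometric l (r `^ (alpha - 1)))).
- by move=> k; exact: lattice_term_ge0.
- by move=> k; rewrite /geometric/= mulr_ge0// exprn_ge0// powR_ge0.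
- move=> k; rewrite /geometric/=.
  apply: (@le_trans _ _ (r `^ (alpha * k%:R) * (r `^ (- k%:R) * l))).
    rewrite ler_wpM2l ?powR_ge0//.
    by have := expR_ge1Dx (- (r `^ (- k%:R) * l)); lra.
  rewrite mulrA -powD mulrC.
  rewrite -powR_mulrn ?powR_ge0// -powRrM ler_wpM2l//.
  by rewrite (_ : alpha * _ + _ = (alpha - 1) * k%:R)//; ring.
- by apply: is_cvg_geometric_series; rewrite ger0_norm ?powR_ge0// powR_lt1// subr_lt0.
Qed.

(** Here 1 - exp(-v) <= 1 suffices, with ratio r^(-alpha). *)
Lemma cvg_lattice_down l : 0 <= l -> cvgn (lattice_down ^~ l).
Proof.
move=> l0; apply: (@series_le_cvg R _ (geometric 1 (r `^ (- alpha)))).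
- by move=> k; exact: lattice_term_ge0.
- by move=> k; rewrite /geometric/= mulr_ge0// exprn_ge0// powR_ge0.
- move=> k; rewrite /geometric/= mul1r.
  apply: (@le_trans _ _ (r `^ (alpha * - k.+1%:R))).
    by rewrite ler_piMr ?powR_ge0// gerBl expR_ge0.
  rewrite -powR_mulrn ?powR_ge0// -powRrM ler_powR//; first exact: ltW.
  by rewrite mulrN mulNr lerN2 ler_wpM2l ?ler_nat// ltW.
- by apply: is_cvg_geometric_series; rewrite ger0_norm ?powR_ge0// powR_lt1// oppr_lt0.
Qed.

Definition lattice_sum l : R := limn (lattice_up ^~ l) + limn (lattice_down ^~ l).

Lemma cvg_lattice_sum l : 0 <= l ->
  (fun K => lattice_up K l + lattice_down K l) @ \oo --> lattice_sum l.
Proof. by move=> l0; apply: cvgD; [exact: cvg_lattice_up|exact: cvg_lattice_down]. Qed.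

Lemma lattice_sumM l : 0 <= l -> lattice_sum (r * l) = r `^ alpha * lattice_sum l.
Proof.
move=> l0; have rl0 : 0 <= r * l by rewrite mulr_ge0// ltW.
have H1 : (fun K => lattice_up K.+1 (r * l) + lattice_down K (r * l)) @ \oo -->
    lattice_sum (r * l).
  apply: cvgD; last exact: cvg_lattice_down.
  by rewrite (cvg_shiftS (lattice_up ^~ (r * l))); exact: cvg_lattice_up.
have H2 : (fun K => r `^ alpha * (lattice_up K l + lattice_down K.+1 l)) @ \oo -->
    r `^ alpha * lattice_sum l.
  apply: cvgM; [exact: cvg_cst|apply: cvgD; first exact: cvg_lattice_up].
  by rewrite (cvg_shiftS (lattice_down ^~ l)); exact: cvg_lattice_down.
rewrite -(cvg_lim (@Rhausdorff R) H1) -(cvg_lim (@Rhausdorff R) H2).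
by congr (limn _); apply/funext => K; exact: lattice_shift.
Qed.

Lemma le_lattice_sum l l' : 0 <= l -> l <= l' -> lattice_sum l <= lattice_sum l'.
Proof.
move=> l0 ll'; have l'0 := le_trans l0 ll'.
apply: lerD; apply: ler_lim; [exact: cvg_lattice_up|exact: cvg_lattice_up| |
  exact: cvg_lattice_down|exact: cvg_lattice_down|].
- by near=> K; apply: ler_sum => k _; exact: le_lattice_term.
- by near=> K; apply: ler_sum => k _; exact: le_lattice_term.
Unshelve. all: by end_near. Qed.

Lemma lattice_sum0 : lattice_sum 0 = 0.
Proof.
rewrite /lattice_sum (_ : lattice_up ^~ 0 = fun=> 0); last first.
  apply/funext => K; rewrite /lattice_up big1// => k _.
  by rewrite /lattice_term mulr0 oppr0 expR0 subrr mulr0.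
rewrite (_ : lattice_down ^~ 0 = fun=> 0) ?lim_cst ?addr0//; last first.
apply/funext => K; rewrite /lattice_down big1// => k _.
by rewrite /lattice_term mulr0 oppr0 expR0 subrr mulr0.
Qed.

Lemma lattice_sum1_gt0 : 0 < lattice_sum 1.
Proof.
apply: ltr_pwDl; last first.
  apply: limr_ge; first exact: cvg_lattice_down.
  by near=> K; apply: sumr_ge0 => k _; exact: lattice_term_ge0.
apply: (@lt_le_trans _ _ (lattice_up 1 1)).
  rewrite /lattice_up big_nat1 /lattice_term mulr_gt0 ?powR_gt0// subr_gt0.
  by rewrite -[ltRHS]expR0 ltr_expR oppr_lt0 mulr_gt0 ?powR_gt0.
apply: nondecreasing_cvgn_le; last exact: cvg_lattice_up.
by apply: nondecreasing_series => k _ _; exact: lattice_term_ge0.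
Unshelve. all: by end_near. Qed.

Lemma lattice_sum_powR (z : int) :
  lattice_sum (r `^ z%:~R) = r `^ (alpha * z%:~R) * lattice_sum 1.
Proof.
have S x : lattice_sum (r `^ (x + 1)) = r `^ alpha * lattice_sum (r `^ x).
  by rewrite addrC powD powRr1 ?ltW// lattice_sumM ?powR_ge0.
have N k : lattice_sum (r `^ k%:R) = r `^ (alpha * k%:R) * lattice_sum 1.
  elim: k => [|k IH]; first by rewrite mulr0 !powRr0 mul1r.
  rewrite -natr1 S IH mulrA -powD; congr (r `^ _ * _); ring.
case: z => k; first exact: N.
rewrite NegzE mulrNz; elim: k => [|k IH].
  have := S (-1); rewrite addrC subrr powRr0 => ->.
  by rewrite mulrA -powD mulrN mulr1 addNr powRr0 mul1r.
have := S (- k.+2%:R); rewrite -{1}natr1 opprD addrNK -[- k.+1%:R]/(- (k.+1%:~R)) IH => E.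
apply: (@mulfI _ (r `^ alpha)); first by rewrite gt_eqF// powR_gt0.
rewrite -E mulrA -powD; congr (r `^ _ * _).
by rewrite -[k.+2%:~R]/(k.+2%:R) -[k.+1%:~R]/(k.+1%:R) -[in RHS]natr1; ring.
Qed.

(** If r^z <= l <= r^(z+1), then by monotonicity and homogeneity both the normalized sum and l^alpha
    lie between r^(alpha z) and r^alpha r^(alpha z). That interval has length at most l^alpha (r -
    1), because r^alpha <= r. *)
Lemma lattice_sum_approx l : 0 <= l ->
  `|lattice_sum l / lattice_sum 1 - l `^ alpha| <= l `^ alpha * (r - 1).
Proof.
rewrite le_eqVlt => /orP[/eqP<-|l0].
  by rewrite lattice_sum0 mul0r powR0 ?gt_eqF// subrr normr0 mul0r.
have lr : 0 < ln r by rewrite ln_gt0.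
pose y := ln l / ln r; have ly : l = r `^ y.
  by rewrite /powR gt_eqF// /y divfK ?gt_eqF// lnK.
pose z : int := Num.floor y.
have zy : z%:~R <= y by exact: floor_le_tmp.
have yz : y <= (z + 1)%:~R by rewrite ltW// floorD1_gt.
have s1 := lattice_sum1_gt0.
have H1 : r `^ (alpha * z%:~R) <= lattice_sum l / lattice_sum 1.
  rewrite ler_pdivlMr// -lattice_sum_powR le_lattice_sum ?powR_ge0//.
  by rewrite ly ler_powR// ltW.
have H2 : lattice_sum l / lattice_sum 1 <= r `^ alpha * r `^ (alpha * z%:~R).
  rewrite ler_pdivrMr// -powD -[X in X + _]mulr1 -mulrDr addrC -intrD1.
  rewrite -lattice_sum_powR le_lattice_sum//; first exact: ltW.
  by rewrite ly ler_powR// ltW.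
have H3 : r `^ (alpha * z%:~R) <= l `^ alpha.
  rewrite ly -powRrM [y * _]mulrC ler_powR//; first exact: ltW.
  by rewrite ler_wpM2l// ltW.
have H4 : l `^ alpha <= r `^ alpha * r `^ (alpha * z%:~R).
  rewrite -powD -[X in X + _]mulr1 -mulrDr addrC -intrD1.
  rewrite ly -powRrM mulrC ler_powR//; first exact: ltW.
  by rewrite ler_wpM2l// ltW.
have H5 : r `^ alpha <= r.
  by rewrite -[leRHS](powRr1 (ltW r_gt0)) ler_powR ?ltW.
have A0 := powR_ge0 r (alpha * z%:~R).
have H6 : r `^ alpha * r `^ (alpha * z%:~R) - r `^ (alpha * z%:~R) <=
    l `^ alpha * (r - 1).
  apply: (@le_trans _ _ (r `^ (alpha * z%:~R) * (r - 1))).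
    rewrite mulrBr mulr1 [leRHS]addrC [leLHS]addrC lerD2l mulrC.
    by rewrite ler_wpM2l.
  by rewrite ler_wpM2r// subr_ge0 ltW.
by rewrite ler_norml; lra.
Qed.

End lattice_power.

(** * Nonnegativity of the heat kernel *)

Section kernel_positivity.
Context {R : realType}.

Lemma negdef_lattice_sum n (alpha r : R) : 0 < alpha -> alpha < 1 -> 1 < r ->
  negdef n (lattice_sum alpha r).
Proof.
move=> a0 a1 r1.
apply: (@negdef_lim R n (fun K l => lattice_up alpha r K l + lattice_down alpha r K l)).
- move=> K; apply: negdefD; apply: negdef_sum => k; apply: negdef_atom;
    exact: powR_ge0.
- by move=> l l0; exact: cvg_lattice_sum.
Qed.

Lemma negdef_powR n (alpha : R) : 0 < alpha -> alpha <= 1 ->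
  negdef n (fun l => l `^ alpha).
Proof.
move=> a0; rewrite le_eqVlt => /orP[/eqP ->|a1].
  have [_ H] := @negdef_id R n; split=> [l l0|t phi t0 Hphi]; first exact: powR_ge0.
  have [mphi [M HM] _] := Hphi.
  (* [powRr1] identifies l^1 with [l] for [0 <= l] only. A constant sequence carries the property
     over, since [posdef_lim] compares functions on the half-line alone. *)
  apply: (@posdef_lim R n (fun _ l => expR (- (t * l)) * phi l) _ M) => [_|_ l l0|l l0].
  - exact: H.
  - rewrite normrM (le_trans _ (HM _ l0))// ler_piMl//.
    by rewrite ger0_norm ?expR_ge0// -expR0 ler_expR oppr_le0 mulr_ge0.
  - by rewrite powRr1//; exact: cvg_cst.
pose r k : R := 1 + k.+1%:R^-1.
have r1 k : 1 < r k by rewrite ltrDl invr_gt0.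
apply: (@negdef_lim R n
  (fun k l => (lattice_sum alpha (r k) 1)^-1 * lattice_sum alpha (r k) l)).
- move=> k; apply: negdefZ; last exact: negdef_lattice_sum.
  by rewrite invr_ge0 ltW// lattice_sum1_gt0.
- move=> l l0; apply/cvgrPdist_le => e e0.
  have H : (fun k => l `^ alpha * (k.+1%:R^-1 : R)) @ \oo --> (0 : R).
    rewrite -[X in _ --> X](mulr0 (l `^ alpha)); apply: cvgM; first exact: cvg_cst.
    exact: cvg_harmonic.
  move/cvgrPdist_le : H => /(_ _ e0); apply: filterS => k.
  rewrite sub0r normrN => H; rewrite distrC mulrC.
  apply: le_trans (lattice_sum_approx a0 a1 (r1 k) l0) _.
  rewrite [X in _ * X](_ : _ = k.+1%:R^-1); last by rewrite /r addrC addKr.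
  exact: le_trans (ler_norm _) H.
Qed.

Lemma integrable_stretchedM n (theta t : R) (h : 'rV[R]_n -> R) :
  0 < theta -> 0 < t -> measurable_fun setT h -> (forall xi, `|h xi| <= 1) ->
  (lebesgue_rV n).-integrable setT
    (EFin \o (fun xi => expR (- (t * enorm xi `^ theta)) * h xi)).
Proof.
move=> th0 t0 mh h1; have [C C0 HC] := @stretched_expR_le_weight R n theta t th0 t0.
apply: (@le_weight_integrable _ _ C).
  apply: measurable_funM => //; apply: measurable_funexpRN.
  apply: measurable_funM => //.
  exact: (measurableT_comp (measurable_powR theta) (@measurable_enorm R n)).
move=> xi; apply: le_trans (HC xi); rewrite normrM ger0_norm ?expR_ge0//.
rewrite mulrC ler_pM ?expR_ge0//.
by rewrite (le_trans (h1 xi))// lerDl dot_ge0.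
Qed.

(** With [alpha = theta / 2], at most 1 since [theta <= 2], [negdef_powR] gives the sign in the
    presence of a test Gaussian. Its parameter [k.+1%:R^-1] then tends to 0, with exp(-t |xi|^theta)
    as majorant. *)
Lemma stable_transform_ge0 n (theta t : R) (x : 'rV[R]_n) :
  0 < theta -> theta <= 2 -> 0 < t ->
  (0 <= \int[lebesgue_rV n]_xi
    (expR (- (t * enorm xi `^ theta)) * cos (dot x xi))%:E)%E.
Proof.
move=> th0 th2 t0.
pose alpha := theta / 2.
have a0 : 0 < alpha by rewrite divr_gt0.
have a1 : alpha <= 1 by rewrite ler_pdivrMr// mul1r.
have E (xi : 'rV[R]_n) : dot xi xi `^ alpha = enorm xi `^ theta.
  rewrite -enorm_sqr -powR_mulrn ?sqrtr_ge0// -powRrM; congr (_ `^ _).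
  by rewrite /alpha; field.
have [_ /(_ t (fun=> 1) (ltW t0) (posdef1 n)) [mphi [M HM] pd]] := negdef_powR n a0 a1.
have k0 k : 0 < k.+1%:R^-1 :> R by rewrite invr_gt0.
pose f_ k (xi : 'rV[R]_n) := (gaussian (k.+1%:R^-1) xi *
  (expR (- (t * dot xi xi `^ alpha)) * 1 * cos (dot x xi)))%:E.
have mf_ k : measurable_fun setT (f_ k).
  by apply: measurable_int; exact: (integrable_radial x (k0 k) mphi HM).
have fi := integrable_stretchedM th0 t0 (measurable_cos_dot x) (fun _ => cos_max _).
have gi : (lebesgue_rV n).-integrable setT
    (EFin \o (fun xi => expR (- (t * enorm xi `^ theta)) * 1)).
  by apply: integrable_stretchedM => // xi; rewrite normr1.
have [] := @dominated_convergence _ _ _ (lebesgue_rV n) setT measurableT f_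
  _ _ mf_ (measurable_int _ fi) _ gi.
- apply: aeW => xi _; apply: cvg_EFin; first by near=> k.
  rewrite -[X in _ --> X]mul1r; apply: cvgM; last first.
    by under eq_fun do rewrite mulr1 E; exact: cvg_cst.
  rewrite -[X in _ --> X]expR0; apply: continuous_cvg; first exact: continuous_expR.
  rewrite -[X in _ --> X]oppr0 -[X in _ --> - X](mul0r (dot xi xi)).
  by apply: cvgN; apply: cvgM; [exact: cvg_harmonic|exact: cvg_cst].
- apply: aeW => xi k _; rewrite lee_fin 2!normrM E mulr1.
  rewrite !(ger0_norm (expR_ge0 _)) -[leRHS]mul1r ler_pM//.
  + by rewrite -expR0 ler_expR oppr_le0 mulr_ge0 ?dot_ge0// ltW.
  + by rewrite ler_piMr ?expR_ge0// cos_max.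
move=> _ _ cv; rewrite -(cvg_lim _ cv)//; apply: lime_ge.
  by apply/cvg_ex; eexists; exact: cv.
by near=> k; exact: pd.
Unshelve. all: by end_near. Qed.

Lemma heat_kernelE n (theta t : R) (x : 'rV[R]_n) :
  heat_kernel theta x t = (2 * pi) ^- n *
    fine (\int[lebesgue_rV n]_xi
      (expR (- (t * enorm xi `^ theta)) * cos (dot x xi))%:E).
Proof.
rewrite /heat_kernel /cintegral /= [X in _ - X]mul0r subr0; congr (_ * _).
rewrite /Rintegral; congr fine; apply: eq_integral => xi _; congr EFin.
by rewrite !mul0r mulr0 !mul1r !(subr0, add0r).
Qed.

Lemma heat_kernel_ge0 n (theta t : R) (x : 'rV[R]_n) :
  0 < theta -> theta <= 2 -> 0 < t -> 0 <= heat_kernel theta x t.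
Proof.
move=> th0 th2 t0; rewrite heat_kernelE mulr_ge0//.
  by rewrite invr_ge0 exprn_ge0// mulr_ge0// pi_ge0.
by rewrite fine_ge0// stable_transform_ge0.
Qed.

End kernel_positivity.

(** * Scaling and lower bound of the kernel near the origin *)

Section kernel_lower_bound.
Context {R : realType}.

Definition cube n (b : 'rV[R]_n) (delta : R) : set 'rV[R]_n :=
  [set x | forall i, `[b 0 i, b 0 i + delta]%classic (x 0 i)].

Lemma measurable_cube n (b : 'rV[R]_n) delta : measurable (cube b delta).
Proof.
by apply: (@measurable_box _ _ (fun i => `[b 0 i, b 0 i + delta]%classic)).
Qed.

Lemma lebesgue_cube n (b : 'rV[R]_n) delta : 0 <= delta ->
  lebesgue_rV n (cube b delta) = (delta ^+ n)%:E.
Proof.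
move=> d0; rewrite (@lebesgue_rV_box _ _ (fun i => `[b 0 i, b 0 i + delta]%classic))//.
transitivity (\prod_(i < n) (delta%:E : \bar R))%E.
  apply: eq_bigr => i _; rewrite lebesgue_measure_itv/= lte_fin ltrDl.
  move: d0; rewrite le_eqVlt => /orP[/eqP<-|->]; first by rewrite ltxx.
  by rewrite -EFinB addrAC subrr add0r.
by rewrite prodEFin prodr_const card_ord.
Qed.

Lemma enorm_scale n (c : R) (x : 'rV[R]_n) : 0 <= c -> enorm (c *: x) = c * enorm x.
Proof.
move=> c0; rewrite /enorm (_ : dot (c *: x) _ = c ^+ 2 * dot x x).
  by rewrite sqrtrM ?sqr_ge0// sqrtr_sqr ger0_norm.
by rewrite /dot mulr_sumr; apply: eq_bigr => i _; rewrite mxE expr2; ring.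
Qed.

Lemma heat_kernel_scale n (theta t : R) (x : 'rV[R]_n) : 0 < theta -> 0 < t ->
  heat_kernel theta x t =
    (t `^ (- theta^-1)) ^+ n * heat_kernel theta (t `^ (- theta^-1) *: x) 1.
Proof.
move=> th0 t0; set c := t `^ _; have c0 : 0 < c by exact: powR_gt0.
have fi := integrable_stretchedM th0 t0 (measurable_cos_dot x) (fun _ => cos_max _).
rewrite !heat_kernelE (integral_rV_scale c0 (measurable_int _ fi)).
have f1 := integrable_stretchedM th0 ltr01 (measurable_cos_dot (c *: x)) (fun _ => cos_max _).
rewrite (_ : (\int[lebesgue_rV n]_xi _ = \int[lebesgue_rV n]_xi
    (expR (- (1 * enorm xi `^ theta)) * cos (dot (c *: x) xi))%:E)%E).
  by rewrite fineM//; [rewrite mulrCA|exact: integrable_fin_num f1].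
apply: eq_integral => xi _ /=; rewrite enorm_scale ?ltW//; congr (expR (- _) * cos _)%:E.
  rewrite powRM ?sqrtr_ge0 ?ltW// /c -powRrM mulNr mulVf ?gt_eqF//.
  by rewrite powR_inv1 ?ltW// mulrA divff ?gt_eqF.
by apply: eq_bigr => i _; rewrite !mxE mulrCA mulrA.
Qed.

Lemma coord_le_enorm n (x : 'rV[R]_n) i : `|x 0 i| <= enorm x.
Proof.
rewrite -sqrtr_sqr ler_wsqrtr// /dot (bigD1 i)//= -expr2 lerDl.
by apply: sumr_ge0 => j _; rewrite -expr2 sqr_ge0.
Qed.

Lemma dot_sqr_le n (eps : R) (w x : 'rV[R]_n) : 0 <= eps ->
  (forall i, `|w 0 i| <= eps) -> dot w x ^+ 2 <= (eps * n%:R) ^+ 2 * dot x x.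
Proof.
move=> e0 we; rewrite -enorm_sqr -exprMn -[leLHS]real_normK ?num_real//.
rewrite lerXn2r ?nnegrE ?mulr_ge0 ?sqrtr_ge0//.
apply: le_trans (ler_norm_sum _ _ _) _.
rewrite (_ : eps * n%:R * _ = \sum_(i < n) eps * enorm x); last first.
  by rewrite sumr_const card_ord -mulr_natr; ring.
by apply: ler_sum => i _; rewrite normrM ler_pM// coord_le_enorm.
Qed.

Lemma integral_stretched_gt0 n (theta : R) : 0 < theta ->
  (0 < \int[lebesgue_rV n]_xi (expR (- (1 * enorm xi `^ theta)) * 1)%:E)%E.
Proof.
move=> th0; pose M := Num.sqrt n%:R `^ theta : R.
apply: (@lt_le_trans _ _ (expR (- M))%:E); first by rewrite lte_fin expR_gt0.
rewrite -[leLHS]mule1 (_ : 1%E = lebesgue_rV n (cube 0 1)); last first.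
  by rewrite lebesgue_cube// expr1n.
rewrite -integral_cst//; last exact: measurable_cube.
rewrite integral_mkcond; apply: ge0_le_integral_nomeas => u _ /=.
  by rewrite patchE; case: ifPn => // _; rewrite lee_fin expR_ge0.
rewrite patchE !mulr1; case: ifPn => [|_]; last by rewrite lee_fin expR_ge0.
rewrite inE/= => Hu; rewrite lee_fin ler_expR lerN2 mul1r.
apply: ge0_ler_powR; rewrite ?nnegrE ?sqrtr_ge0//; first exact: ltW.
apply: ler_wsqrtr.
rewrite (_ : n%:R = \sum_(i < n) (1 : R)); last by rewrite sumr_const card_ord.
apply: ler_sum => i _; have := Hu i; rewrite /= in_itv/= mxE add0r => /andP[u0 u1].
by rewrite -expr2 exprn_ile1.
Qed.

Lemma heat_kernel1_lower_bound n (theta : R) : 0 < theta ->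
  exists eps c : R, [/\ 0 < eps, 0 < c &
    forall w : 'rV[R]_n, (forall i, `|w 0 i| <= eps) -> c <= heat_kernel theta w 1].
Proof.
move=> th0.
have [C C0 HC] := @stretched_expR_le_weight R n theta 1 th0 ltr01.
pose e (xi : 'rV[R]_n) := expR (- (1 * enorm xi `^ theta)).
have i0 : (lebesgue_rV n).-integrable setT (EFin \o (fun xi => e xi * 1)).
  by apply: integrable_stretchedM => // xi; rewrite normr1.
have me : measurable_fun setT e.
  apply: measurable_funexpRN; apply: measurable_funM => //.
  exact: (measurableT_comp (measurable_powR theta) (@measurable_enorm R n)).
have i2 : (lebesgue_rV n).-integrable setT (EFin \o (fun xi => dot xi xi * e xi)).
  apply: (@le_weight_integrable _ _ C).
    by apply: measurable_funM => //; exact: measurable_dotxx.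
  move=> xi; apply: le_trans (HC xi).
  by rewrite ger0_norm ?mulr_ge0 ?expR_ge0 ?dot_ge0// ler_wpM2r ?expR_ge0// lerDr.
pose I0 := fine (\int[lebesgue_rV n]_xi (e xi * 1)%:E).
pose I2 := fine (\int[lebesgue_rV n]_xi (dot xi xi * e xi)%:E).
have I0gt : 0 < I0.
  rewrite -lte_fin /I0 fineK; first exact: integral_stretched_gt0.
  exact: integrable_fin_num i0.
have I2ge : 0 <= I2.
  by apply: fine_ge0; apply: integral_ge0 => xi _; rewrite lee_fin mulr_ge0 ?expR_ge0 ?dot_ge0.
have pin : 0 < (2 * pi) ^- n :> R by rewrite invr_gt0 exprn_gt0// mulr_gt0// pi_gt0.
pose D := I0 + n%:R ^+ 2 * I2.
have D0 : 0 < D by rewrite ltr_pwDl// mulr_ge0.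
(* The quadratic bound on cosine yields the lower bound I0 - (eps n)^2 I2 / 2 for the integral. As
   [eps <= 1], (eps n)^2 I2 is at most eps n^2 I2, hence at most [I0] by the choice of [D], and half
   of [I0] remains. *)
pose eps := I0 / D.
have eps0 : 0 < eps by rewrite divr_gt0.
have eps1 : eps <= 1 by rewrite ler_pdivrMr// mul1r lerDl mulr_ge0.
exists eps, ((2 * pi) ^- n * (I0 / 2)); split=> // [|w weps].
  by rewrite mulr_gt0// divr_gt0.
rewrite heat_kernelE ler_pM2l//.
have ic : (lebesgue_rV n).-integrable setT (EFin \o (fun xi => e xi * cos (dot w xi))).
  exact: (integrable_stretchedM th0 ltr01 (measurable_cos_dot w) (fun _ => cos_max _)).
pose k := (eps * n%:R) ^+ 2 / 2.
have k0 : 0 <= k by rewrite divr_ge0// sqr_ge0.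
rewrite -lee_fin fineK; last exact: integrable_fin_num ic.
apply: (@le_trans _ _ (I0 - k * I2)%:E).
  rewrite lee_fin.
  suff : (eps * n%:R) ^+ 2 * I2 <= I0 by rewrite /k; lra.
  apply: (@le_trans _ _ (eps * (n%:R ^+ 2 * I2))).
    rewrite exprMn -mulrA ler_wpM2r// ?mulr_ge0 ?exprn_ge0//.
    by rewrite expr2 ler_piMr// ltW.
  rewrite /eps mulrAC ler_pdivrMr// ler_pM2l//.
  by rewrite /D lerDr ltW.
rewrite EFinB EFinM /I0 /I2 !fineK; [|exact: integrable_fin_num i2|exact: integrable_fin_num i0].
rewrite -integralZl// -integralB//; last exact: integrableZl i2.
apply: le_integral => //.
  by apply: integrableB => //; exact: integrableZl i2.
move=> xi _; rewrite -EFinM -EFinB lee_fin mulr1 mulrA -[X in X - _]mul1r -mulrBl mulrC.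
rewrite ler_wpM2l ?expR_ge0//; apply: le_trans (cos_ge_quadratic _).
have := dot_sqr_le xi (ltW eps0) weps; rewrite /k; lra.
Qed.

End kernel_lower_bound.

(** * Divergence at time zero and null sections *)

Section blowup_tools.
Context {R : realType}.
Notation mu := (@lebesgue_measure R).

Lemma heat_kernel_lower_bound n (theta : R) : 0 < theta ->
  exists eps c : R, [/\ 0 < eps, 0 < c &
    forall t (w : 'rV[R]_n), 0 < t -> (forall i, `|w 0 i| <= eps * t `^ theta^-1) ->
      c * (t `^ (- theta^-1)) ^+ n <= heat_kernel theta w t].
Proof.
move=> th0; have [eps [c [e0 c0 H]]] := @heat_kernel1_lower_bound R n theta th0.
exists eps, c; split=> // t w t0 wt; rewrite heat_kernel_scale// mulrC.
rewrite ler_wpM2l ?exprn_ge0 ?powR_ge0//; apply: H => i.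
rewrite mxE normrM ger0_norm ?powR_ge0// powRN mulrC ler_pdivrMr ?powR_gt0//.
Qed.

(* The substitution s = 2x shows that the integral I satisfies I >= I + 1/2. *)
Lemma integral_powRN1_near0 (s0 : R) : 0 < s0 ->
  (\int[mu]_(s in `]0%R, s0[) (s `^ (-1))%:E = +oo)%E.
Proof.
move=> s00; pose f (b : R) := ((fun s => (s `^ (-1))%:E) \_ (`]0%R, b[%classic : set R))%E.
have mf b : measurable_fun setT (f b).
  apply/(measurable_restrictT _ _).1 => //; apply: measurable_funTS.
  by apply/measurable_EFinP; exact: measurable_powR.
have f0 b s : (0 <= f b s)%E.
  by rewrite /f patchE; case: ifPn => // _; rewrite lee_fin powR_ge0.
rewrite integral_mkcond -/(f s0).
have E : (\int[mu]_s f s0 s = \int[mu]_s f (s0 / 2)%R s)%E.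
  have mf2 : measurable_fun setT (fun s : R => f s0 (2 * s + 0)%R).
    apply: measurableT_comp (mf s0) _.
    by apply: measurable_funD => //; exact: measurable_funM.
  rewrite (@ge0_integral_affine R 2 0)// -ge0_integralZl//.
  apply: eq_integral => s _; rewrite addr0 /f !patchE.
  have -> : (2 * s \in (`]0%R, s0[%classic : set R)) = (s \in (`]0%R, (s0 / 2)[%classic : set R)).
    by apply/idP/idP; rewrite !inE/= !in_itv/= => /andP[a b]; apply/andP; split; lra.
  case: ifPn => [|_]; last by rewrite mule0.
  rewrite inE/= in_itv/= => /andP[/ltW s1 _].
  by rewrite -EFinM powRM// mulrA powR_inv1// divff// mul1r.
have G : (\int[mu]_s f (s0 / 2)%R s + (2^-1)%:E <= \int[mu]_s f s0 s)%E.
  pose h := ((fun s : R => (s0^-1)%:E) \_ (`[(s0 / 2)%R, s0[%classic : set R))%E.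
  have mh : measurable_fun setT h.
    by apply/(measurable_restrictT _ _).1.
  have h0 s : (0 <= h s)%E.
    by rewrite /h patchE; case: ifPn => // _; rewrite lee_fin invr_ge0 ltW.
  have -> : ((2^-1)%:E = \int[mu]_s h s)%E.
    rewrite -integral_mkcond integral_cst//= lebesgue_measure_itv/= lte_fin.
    rewrite ifT; last by rewrite ltr_pdivrMr//; lra.
    by rewrite -EFinB -EFinM; congr EFin; field; rewrite gt_eqF.
  rewrite -ge0_integralD//; last exact: mf.
  apply: ge0_le_integral_nomeas => s _.
    by rewrite adde_ge0.
  rewrite /h /f !patchE.
  have [s1|s1] := ltP s (s0 / 2).
    rewrite [in X in (_ + X)%E]memNset ?adde0; last first.
      by rewrite /= in_itv/= => /andP[]; rewrite leNgt s1.
    case: ifPn => [/[!inE]/= |_]; last by case: ifPn => // _; rewrite lee_fin powR_ge0.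
    rewrite in_itv/= => /andP[s2 _]; rewrite mem_set//= in_itv/= s2/=; lra.
  rewrite memNset ?add0e; last first.
    by rewrite /= in_itv/= => /andP[_]; rewrite ltNge s1.
  case: ifPn => [/[!inE]/= |_]; last by case: ifPn => // _; rewrite lee_fin powR_ge0.
  rewrite in_itv/= => /andP[_ s2].
  have sg0 : 0 < s by apply: lt_le_trans s1; rewrite divr_gt0.
  rewrite mem_set/= ?in_itv/= ?sg0// lee_fin (powR_inv1 (ltW sg0)).
  by rewrite lef_pV2 ?posrE// ltW.
have I0 : (0 <= \int[mu]_s f s0 s)%E by exact: integral_ge0.
move: G; rewrite -E {E}; case: (\int[mu]_s f s0 s)%E I0 => [r| |]//= _.
by rewrite lee_fin => H; exfalso; lra.
Qed.

(** Tonelli for the indicator of [A]. It makes the lower bound on [u (y, s)] usable under the space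
    integral at almost every fixed time [s]. *)
Lemma ae_null_ysection n (A : set ('rV[R]_n * measurableTypeR R)) :
  measurable A -> spacetime_measure A = 0%E ->
  {ae mu, forall s, lebesgue_rV n (ysection A s) = 0%E}.
Proof.
move=> mA A0.
have mf : measurable_fun setT (fun w => (\1_A w)%:E : \bar R).
  by apply/measurable_EFinP; exact: measurable_indic.
have f0 w : (0 <= (\1_A w)%:E :> \bar R)%E by rewrite lee_fin.
have E : (\int[mu]_s lebesgue_rV n (ysection A s) = 0)%E.
  rewrite -A0 /spacetime_measure -[in RHS](setIT A) -(integral_indic _ measurableT)//.
  rewrite fubini_tonelli2//; apply: eq_integral => s _.
  rewrite -[in LHS](setIT (ysection A s)) -(integral_indic _ measurableT)//; last first.
    exact: measurable_ysection.
  apply: eq_integral => y _; rewrite !indicE; congr (_%:R%:E).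
  by rewrite mem_ysection.
have mg := measurable_fun_ysection (lebesgue_rV n) mA.
have := (ae_eq_integral_abs mu measurableT mg).1.
under eq_integral do rewrite gee0_abs//.
by move=> /(_ E); apply: filterS => s; apply.
Qed.

Lemma enorm_le n (B : R) (y : 'rV[R]_n) : 0 <= B -> (forall i, `|y 0 i| <= B) ->
  enorm y <= n%:R * B.
Proof.
move=> B0 H; rewrite -[leRHS]ger0_norm ?mulr_ge0// -sqrtr_sqr ler_wsqrtr//.
apply: (@le_trans _ _ (\sum_(i < n) B ^+ 2)).
  apply: ler_sum => i _; rewrite -expr2 -[leLHS]real_normK ?num_real//.
  by rewrite lerXn2r ?nnegrE.
rewrite sumr_const card_ord exprMn -[leLHS]mulr_natl ler_wpM2r ?sqr_ge0//.
by rewrite -natrX ler_nat; case: (n) => // k; rewrite expnS leq_pmulr.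
Qed.

End blowup_tools.

(** * Blow-up of the nonlinear term *)

Section blowup.
Context {R : realType}.
Notation mu := (@lebesgue_measure R).

Lemma set1_rVE n (a : 'rV[R]_n) :
  [set a] = [set x : 'rV[R]_n | forall i, [set a 0 i] (x 0 i)].
Proof.
apply/seteqP; split=> [x -> i //|x /= H]; apply/rowP => i; exact: H.
Qed.

Lemma measurable_set1_rV n (a : 'rV[R]_n) : measurable [set a].
Proof.
by rewrite set1_rVE; apply: (@measurable_box _ _ (fun i => [set a 0 i])) => i.
Qed.

Lemma lebesgue_rV_set1 n (a : 'rV[R]_n) : (1 <= n)%N -> lebesgue_rV n [set a] = 0%E.
Proof.
case: n a => // n a _; rewrite set1_rVE.
rewrite (@lebesgue_rV_box _ _ (fun i => [set a 0 i])) => [|i]; last exact: measurable_set1.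
by rewrite big_ord_recl lebesgue_measure_set1 mul0e.
Qed.

(* The solution dominates the kernel, hence u(y,s)^p >= C s^(-Np/theta) for
   |y - z| <= eps s^(1/theta); integrated over such y this gives at least
   K s^((N - kappa - Np)/theta) >= K s^(-1), which is not integrable at 0. *)
Lemma no_local_solution n (theta p gamma kappa : R) (z : 'rV[R]_n) :
  (1 <= n)%N -> 0 < theta -> theta <= 2 -> 0 <= p ->
  1 + (theta - kappa) / n%:R <= p ->
  (forall eps : R, 0 < eps -> exists2 c2 : R, 0 < c2 &
    forall s (y : 'rV[R]_n), 0 < s -> s <= 1 -> y != 0 ->
      (forall i, `|y 0 i - z 0 i| <= eps * s `^ theta^-1) ->
      c2 * s `^ (- (kappa / theta)) <= enorm y `^ (- gamma)) ->
  ~ has_local_solution theta p gamma (dirac z).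
Proof.
move=> n1 th0 th2 p0 hp Hw [T [T0 [u [_ u0 [A [mA A0 subA]]]]]].
have [eps [c [e0 c0 HG]]] := @heat_kernel_lower_bound R n theta th0.
have [c2 c20 Hc2] := Hw eps e0.
(* A finite time inside the interval of existence; [T1 <= 1] keeps all times at most 1, where powers
   of [s] decrease with the exponent. *)
have [T1 [T10 T1T T11]] : exists T1 : R, [/\ 0 < T1, (T1%:E < T)%E & T1 <= 1].
  case: T T0 {u0 subA} => [T| |]//=; last by exists 1; rewrite ltry.
  rewrite lte_fin => T0; exists (Num.min 1 (T / 2)).
  rewrite lt_min ltr01 divr_gt0//= lte_fin ge_min lexx; split=> //.
  by rewrite gt_min; apply/orP; right; lra.
have G0 x t : 0 < t -> 0 <= heat_kernel theta (x : 'rV[R]_n) t.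
  by move=> t0; exact: heat_kernel_ge0.
have int0 (w : 'rV[R]_n) t : (0 <= \int[lebesgue_measure]_(s in `]0%R, t[)
    \int[lebesgue_rV n]_y
      ((heat_kernel theta (w - y) (t - s) * enorm y `^ (- gamma))%:E * u (y, s) `^ p))%E.
  apply: integral_ge0 => s /=; rewrite in_itv/= => /andP[_ st].
  apply: integral_ge0 => y _; rewrite mule_ge0 ?poweR_ge0// lee_fin.
  by rewrite mulr_ge0 ?powR_ge0// G0// subr_gt0.
have sol (w : 'rV[R]_n) (t : R) : 0 < t -> t <= T1 -> ~ A (w, t) ->
    (u (w, t) < +oo /\ u (w, t) = \int[\d_z]_y (heat_kernel theta (w - y) t)%:E +
     \int[lebesgue_measure]_(s in `]0%R, t[)
           \int[lebesgue_rV n]_y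
             ((heat_kernel theta (w - y) (t - s) * enorm y `^ (- gamma))%:E
              * u (y, s) `^ p))%E.
  move=> t0 tT nA; have := contra_not (@subA (w, t)) nA.
  rewrite /= => /contrapT; apply; split=> //=.
  by apply: le_lt_trans T1T; rewrite lee_fin.
have ulow (w : 'rV[R]_n) (t : R) : 0 < t -> t <= T1 -> ~ A (w, t) ->
    (forall i, `|w 0 i - z 0 i| <= eps * t `^ theta^-1) ->
    ((c * (t `^ (- theta^-1)) ^+ n)%:E <= u (w, t))%E.
  move=> t0 tT nA wz; have [_ ->] := sol w t t0 tT nA.
  apply: (@le_trans _ _ (heat_kernel theta (w - z) t)%:E).
    by rewrite lee_fin; apply: HG => // i; rewrite !mxE.
  apply: le_trans (leeDl _ (int0 w t)).
  apply: (@ge0_le_dirac_integral _ _ R z (fun y => (heat_kernel theta (w - y) t)%:E)).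
    exact: measurable_set1_rV.
  by move=> y; rewrite lee_fin G0.
(* Since t will be at least T1 / 2, this is at most eps / 2 times (t / 2)^(1/theta): half of the
   admissible distance from [x] to [y]. *)
pose r := eps / 2 * (T1 / 2 / 2) `^ theta^-1.
have r0 : 0 < r by rewrite !mulr_gt0 ?powR_gt0// ?divr_gt0.
(* Otherwise the null set [A] would contain a box of positive measure. *)
have [x [t [tT0 tT xz nA]]] : exists x : 'rV[R]_n, exists t : R,
    [/\ T1 / 2 <= t, t <= T1, (forall i, `|x 0 i - z 0 i| <= r) & ~ A (x, t)].
  apply: contrapT => H.
  have : ((cube z r `*` `[T1 / 2, T1]%classic) : set (_ * measurableTypeR R)) `<=` A.
    move=> [x t] [/= xz]; rewrite in_itv/= => /andP[t1 t2].
    apply: contrapT => nA; apply: H; exists x, t; split=> // i.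
    have := xz i; rewrite /= in_itv/= => /andP[a b].
    by rewrite ger0_norm ?subr_ge0// lerBlDl.
  move=> sub; have mB : measurable ((cube z r `*` `[T1 / 2, T1]%classic) :
      set (_ * measurableTypeR R)).
    by apply: measurableX => //; exact: measurable_cube.
  have : (lebesgue_rV n \x mu)%E (cube z r `*` `[T1 / 2, T1]%classic) = 0%E.
    exact: subset_measure0 mB mA sub A0.
  rewrite product_measure1E//; last exact: measurable_cube.
  have muI : mu `[T1 / 2, T1]%classic = (T1 - T1 / 2)%:E.
    rewrite lebesgue_measure_itv/= lte_fin ifT -?EFinB//.
    by rewrite ltr_pdivrMr//; lra.
  rewrite [X in (X * _)%E](lebesgue_cube z (ltW r0)) [X in (_ * X)%E]muI.
  rewrite -EFinM => -[] /eqP; rewrite gt_eqF//.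
  by rewrite mulr_gt0 ?exprn_gt0// subr_gt0 ltr_pdivrMr//; lra.
have t0 : 0 < t by apply: lt_le_trans tT0; rewrite divr_gt0.
have ith0 : 0 < theta^-1 by rewrite invr_gt0.
(* For s < s0, s^(1/theta) is at most half of (t / 2)^(1/theta), which is the other half of the
   admissible distance; also s0 <= t / 2, so t - s >= t / 2. *)
pose s0 := 2^-1 `^ theta * (t / 2).
have s00 : 0 < s0 by rewrite mulr_gt0 ?powR_gt0 ?invr_gt0// divr_gt0.
have s0t : s0 <= t / 2.
  rewrite ler_piMl// ?divr_ge0 ?(ltW t0)// -[leRHS](powRr0 2^-1).
  apply: ger_powR; last exact: ltW.
  by apply/andP; split; lra.
(* Lower bounds of the three factors of the integrand: the kernel at time t - s <= t, the potential,
   and u^p. *)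
pose q s := c * (t `^ (- theta^-1)) ^+ n * (c2 * s `^ (- (kappa / theta)))
  * (c * (s `^ (- theta^-1)) ^+ n) `^ p.
pose K := c * (t `^ (- theta^-1)) ^+ n * c2 * c `^ p * eps ^+ n.
have K0 : 0 < K by rewrite !mulr_gt0 ?exprn_gt0 ?powR_gt0.
have q0 s : 0 < s -> 0 <= q s.
  by move=> sg0; rewrite !mulr_ge0 ?exprn_ge0 ?powR_ge0 ?ltW.
have qK s : 0 < s -> s <= 1 -> K * s `^ (-1) <= q s * (eps * s `^ theta^-1) ^+ n.
  move=> sg0 s1.
  have powD (a b : R) : s `^ (a + b) = s `^ a * s `^ b.
    by rewrite powRD// (gt_eqF sg0) implybT.
  rewrite (_ : q s * _ = K * s `^ (- (kappa / theta) + (- (theta^-1 * n%:R * p))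
      + theta^-1 * n%:R)); last first.
    have h1 : ((s `^ (- theta^-1)) ^+ n) `^ p = s `^ (- (theta^-1 * n%:R * p)).
      by rewrite -powR_mulrn ?powR_ge0// -!powRrM; congr (_ `^ _); ring.
    have h2 : (s `^ theta^-1) ^+ n = s `^ (theta^-1 * n%:R).
      by rewrite -powR_mulrn ?powR_ge0// -powRrM.
    rewrite /q /K powRM ?exprn_ge0 ?powR_ge0 ?(ltW c0)// h1 exprMn h2 !powD; ring.
  (* It remains to see that the exponent is at most -1. Multiplied by [theta] it is n - kappa - n p,
     which [hp] bounds by -theta. *)
  rewrite ler_pM2l// ger_powR ?sg0//.
  have nR : 0 < n%:R :> R by rewrite ltr0n.
  have : (1 + (theta - kappa) / n%:R) * n%:R <= p * n%:R by rewrite ler_wpM2r.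
  rewrite mulrDl divfK ?gt_eqF// mul1r => h.
  rewrite -(ler_pM2l th0).
  rewrite (_ : theta * (_ + _ + _) = - kappa - n%:R * p + n%:R); first by lra.
  by field; rewrite gt_eqF.
pose F s := (\int[lebesgue_rV n]_y
  ((heat_kernel theta (x - y) (t - s) * enorm y `^ (- gamma))%:E * u (y, s) `^ p))%E.
have inner s : 0 < s -> s < s0 -> lebesgue_rV n (ysection A s) = 0%E ->
    ((K * s `^ (-1))%:E <= F s)%E.
  move=> sg0 ss0 As0.
  have st : s < t by apply: (lt_le_trans ss0); apply: (le_trans s0t); lra.
  have ts : 0 < t - s by rewrite subr_gt0.
  have s1 : s <= 1 by lra.
  pose delta := eps * s `^ theta^-1.
  have d0 : 0 <= delta by rewrite mulr_ge0 ?powR_ge0 ?ltW.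
  apply: (@le_trans _ _ (q s * delta ^+ n)%:E); first by rewrite lee_fin qK.
  rewrite EFinM -(lebesgue_cube z d0) -integral_cst; last exact: measurable_cube.
  rewrite integral_mkcond.
  (* The origin joins the exceptional set because [Hc2] speaks of [y != 0] only; it is null since
     [n] is positive. *)
  apply: (@ae_ge0_le_integral_nomeas _ _ _ _ setT (ysection A s `|` [set 0])).
  - by [].
  - by apply: measurableU; [exact: measurable_ysection|exact: measurable_set1_rV].
  - rewrite null_set_setU//; [exact: measurable_ysection|exact: measurable_set1_rV|].
    exact: lebesgue_rV_set1.
  - apply/(measurable_restrictT _ _).1 => //; exact: measurable_cube.
  - by move=> y _; rewrite patchE; case: ifPn => // _; rewrite lee_fin q0.
  - move=> y _; rewrite mule_ge0 ?poweR_ge0// lee_fin.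
    by rewrite mulr_ge0 ?powR_ge0// G0.
  move=> y _ /not_orP[nAy /eqP y0]; rewrite patchE; case: ifPn => [|_]; last first.
    by rewrite mule_ge0 ?poweR_ge0// lee_fin mulr_ge0 ?powR_ge0// G0.
  rewrite inE => yc.
  have yz i : `|y 0 i - z 0 i| <= delta.
    have := yc i; rewrite /= in_itv/= => /andP[a b].
    by rewrite ger0_norm ?subr_ge0// lerBlDl.
  rewrite /q EFinM; apply: lee_pmul.
  - by rewrite lee_fin !mulr_ge0 ?exprn_ge0 ?powR_ge0 ?ltW.
  - by rewrite lee_fin powR_ge0.
  - rewrite lee_fin; apply: ler_pM.
    + by rewrite !mulr_ge0 ?exprn_ge0 ?powR_ge0 ?ltW.
    + by rewrite !mulr_ge0 ?powR_ge0 ?ltW.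
    + apply: (@le_trans _ _ (c * ((t - s) `^ (- theta^-1)) ^+ n)).
        rewrite ler_wpM2l ?(ltW c0)// lerXn2r ?nnegrE ?powR_ge0// !powRN.
        rewrite lef_pV2 ?posrE ?powR_gt0//.
        by apply: ge0_ler_powR; rewrite ?nnegrE ?(ltW ith0)//; lra.
      apply: HG => // i; rewrite !mxE.
      have e1 : (t / 2) `^ theta^-1 <= (t - s) `^ theta^-1.
        by apply: ge0_ler_powR; rewrite ?nnegrE ?(ltW ith0)//; lra.
      have e2 : s `^ theta^-1 <= 2^-1 * (t / 2) `^ theta^-1.
        apply: (@le_trans _ _ (s0 `^ theta^-1)).
          by apply: ge0_ler_powR; rewrite ?nnegrE ?(ltW ith0)//; lra.
        rewrite /s0 powRM ?powR_ge0 ?divr_ge0 ?(ltW t0)// -powRrM divff ?gt_eqF//.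
        by rewrite powRr1 ?invr_ge0.
      have e3 : r <= eps / 2 * (t / 2) `^ theta^-1.
        rewrite ler_wpM2l ?divr_ge0 ?(ltW e0)//.
        by apply: ge0_ler_powR; rewrite ?nnegrE ?(ltW ith0)//; lra.
      have e4 : delta <= eps / 2 * (t / 2) `^ theta^-1.
        by rewrite /delta -mulrA ler_wpM2l ?(ltW e0).
      have e5 : eps * (t / 2) `^ theta^-1 <= eps * (t - s) `^ theta^-1.
        by rewrite ler_wpM2l ?(ltW e0).
      have -> : x 0 i - y 0 i = (x 0 i - z 0 i) - (y 0 i - z 0 i) by ring.
      apply: le_trans (ler_normB _ _) _.
      by have := xz i; have := yz i; lra.
    + by apply: Hc2.
  - rewrite -poweR_EFin; apply: gt0_ler_poweR => //.
    + by rewrite in_itv/= leey andbT lee_fin mulr_ge0 ?exprn_ge0 ?powR_ge0 ?ltW.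
    + rewrite in_itv/= leey andbT; apply: u0; split=> //=.
      by apply: le_lt_trans T1T; rewrite lee_fin; lra.
    + apply: ulow => //; first lra.
      by move=> Ays; apply: nAy; rewrite /ysection/= inE.
have [ufin uE] := sol x t t0 tT nA.
suff : (+oo <= u (x, t))%E by rewrite leye_eq => /eqP uoo; rewrite uoo in ufin.
rewrite uE; apply: le_trans (leeDr _ _); last first.
  by apply: integral_ge0 => y _; rewrite lee_fin G0.
have [Z [mZ Z0 subZ]] := ae_null_ysection mA A0.
rewrite -[leLHS](_ : (\int[mu]_(s in `]0%R, s0[) (K * s `^ (-1))%:E = +oo)%E); last first.
  under eq_integral do rewrite EFinM.
  rewrite ge0_integralZl//; last 3 first.
  - by apply/measurable_EFinP; apply: measurable_funTS; exact: measurable_powR.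
  - by move=> s _; rewrite lee_fin powR_ge0.
  - by rewrite lee_fin ltW.
  by rewrite integral_powRN1_near0// gt0_muley.
rewrite integral_mkcond [leRHS]integral_mkcond.
apply: (@ae_ge0_le_integral_nomeas _ _ _ _ setT Z) => //.
- apply/(measurable_restrictT _ _).1 => //; apply/measurable_EFinP.
  by apply: measurable_funM => //; apply: measurable_funTS; exact: measurable_powR.
- by move=> s _; rewrite patchE; case: ifPn => // _; rewrite lee_fin mulr_ge0 ?powR_ge0 ?ltW.
- move=> s _; rewrite patchE; case: ifPn => //; rewrite inE/= in_itv/= => /andP[_ st].
  apply: integral_ge0 => y _; rewrite mule_ge0 ?poweR_ge0// lee_fin.
  by rewrite mulr_ge0 ?powR_ge0// G0// subr_gt0.
move=> s _ nZ; rewrite !patchE; case: ifPn => [|_]; last first.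
  case: ifPn => //; rewrite inE/= in_itv/= => /andP[_ st].
  apply: integral_ge0 => y _; rewrite mule_ge0 ?poweR_ge0// lee_fin.
  by rewrite mulr_ge0 ?powR_ge0// G0// subr_gt0.
rewrite inE/= in_itv/= => /andP[sg0 ss0]; rewrite mem_set/=; last first.
  by rewrite in_itv/= sg0/=; lra.
apply: inner => //; apply: contrapT => H; apply: nZ; apply: subZ.
exact: H.
Qed.

End blowup.

(** * Lower bounds on the potential *)

Section potential.
Context {R : realType}.

Lemma enorm_gt0 n (y : 'rV[R]_n) : y != 0 -> 0 < enorm y.
Proof.
move=> y0; have [i yi] : exists i, y 0 i != 0.
  apply/existsP; apply: contra_neqT y0 => /existsPn H; apply/rowP => i.
  by rewrite mxE; apply/eqP; have := H i; rewrite negbK.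
by apply: lt_le_trans (coord_le_enorm y i); rewrite normr_gt0.
Qed.

Lemma powR_enorm_ge n (gamma B : R) (y : 'rV[R]_n) : 0 <= gamma -> y != 0 ->
  (forall i, `|y 0 i| <= B) -> (n%:R * B) `^ (- gamma) <= enorm y `^ (- gamma).
Proof.
move=> g0 y0 yB; have ygt := enorm_gt0 y0.
(* A negative [B] could only bound a vector without coordinates, and that vector is zero. *)
have B0 : 0 <= B.
  rewrite leNgt; apply/negP => B0; move: y0; rewrite -[y]scale1r; apply/negP; rewrite negbK.
  by apply/eqP/rowP => i; have := le_lt_trans (yB i) B0; rewrite normr_lt0.
have yle := enorm_le B0 yB.
have Bgt := lt_le_trans ygt yle.
rewrite !powRN lef_pV2 ?posrE ?powR_gt0//.
by apply: ge0_ler_powR; rewrite ?nnegrE ?(ltW ygt) ?(ltW Bgt).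
Qed.

End potential.

Theorem mainTheorem6 (R : realType) (N : nat) (theta p gamma : R)
    (z : 'rV[R]_N)
    (N_ge1 : (1 <= N)%N)
    (theta_gt0 : 0 < theta) (theta_le2 : theta <= 2)
    (p_gt1 : 1 < p)
    (gamma_gt0 : 0 < gamma) (gamma_lt : gamma < Num.min theta N%:R)
    (gamma_lt_theta2 : theta < 2 -> gamma < theta * (p - 1)) :
  (1 + (theta - gamma) / N%:R <= p -> z = 0 ->
     ~ has_local_solution theta p gamma (dirac z)) /\
  (1 + theta / N%:R <= p ->
     ~ has_local_solution theta p gamma (dirac z)).
Proof.
have th_gt0 : 0 < theta^-1 by rewrite invr_gt0.
have N0 : 0 < N%:R :> R by rewrite ltr0n.
have p0 : 0 <= p by apply: ltW; apply: lt_trans p_gt1.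
split=> [hp z0|hp].
  (* On the cube of size eps s^(1/theta) at the origin the norm is at most N eps s^(1/theta), so the
     potential gains the factor s^(-gamma/theta). *)
  apply: (no_local_solution (kappa := gamma)) => // eps e0.
  exists ((N%:R * eps) `^ (- gamma)) => [|s y s0 s1 y0 yz].
    by rewrite powR_gt0 ?mulr_gt0.
  rewrite (_ : _ * _ = (N%:R * (eps * s `^ theta^-1)) `^ (- gamma)).
    apply: powR_enorm_ge => //; first exact: ltW.
    by move=> i; have := yz i; rewrite z0 mxE subr0.
  rewrite [in RHS]mulrA [RHS]powRM ?mulr_ge0 ?powR_ge0 ?ltW// -powRrM.
  by congr (_ * _ `^ _); rewrite mulrN mulrC.
(* For s <= 1 the cube stays in a fixed bounded set, where the potential is at least a positive
   constant. *)
apply: (no_local_solution (kappa := 0)) => //; first by rewrite subr0.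
move=> eps e0; have z0 : 0 <= enorm z by exact: sqrtr_ge0.
exists ((N%:R * (enorm z + eps)) `^ (- gamma)) => [|s y s0 s1 y0 yz].
  by rewrite powR_gt0// mulr_gt0// ltr_wpDl.
rewrite mul0r oppr0 powRr0 mulr1; apply: powR_enorm_ge => //; first exact: ltW.
move=> i; rewrite -[y 0 i](subrK (z 0 i)) addrC.
apply: le_trans (ler_normD _ _) _; apply: lerD; first exact: coord_le_enorm.
apply: le_trans (yz i) _; rewrite ler_piMr ?(ltW e0)//.
rewrite -[leRHS](powRr0 s); apply: ger_powR; first by rewrite s0.
exact: ltW.
Qed.
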